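(* Let $f:\mathbb{R}^d\to\mathbb{R}$ be SPB with parameters $\mathrm{R}_1,\mathrm{R}_2,m$, with $\inf_{\mathbb{R}^d}f>-\infty$. Fix $\sigma>0$, $x^0\in\mathbb{R}^d$ and $\{\tau_k\}\subset(0,1]$, and generate $\{x^k\}$ by: for $k=0,1,2,\dots$, draw $u^k\sim\mathcal{N}(0,I)$ independently of the past, set $v^k=\sigma^{-1}[f(x^k+\sigma u^k)-f(x^k)]u^k$ and \[x^{k+1}=x^k-\tau_k\frac{v^k}{\|x^k\|^{2m}+1}.\] Let $\mathbb{E}$ denote expectation over all the $u^k$, $f_\sigma(x)=\mathbb{E}_{u\sim\mathcal{N}(0,I)}[f(x+\sigma u)]$, $\mathcal{A}=2^{2m-2}\mathrm{R}_1\sigma^{m-1}(m+1+d)^{(m+1)/2}+\sigma^{-1}\mathrm{R}_2\sqrt d$, $\mathcal{B}=2^{2m-2}\sigma^{-1}\mathrm{R}_1\sqrt d$, $\mathcal{C}=2^{m-1}\sigma^{-1}\mathrm{R}_1\sqrt d$. Then for all $k\ge0$, \[\mathbb{E}[f_\sigma(x^{k+1})]\le\mathbb{E}[f_\sigma(x^k)]+\frac{\mathcal{H}_{(2)}\tau_k^2(\mathcal{A}+\mathcal{B})}{2}+\frac{\mathcal{C}}{m+2}\mathcal{H}_{(m+2)}\tau_k^{m+2},\] and for any integer $T>0$, \[\min_{0\le k\le T}\widetilde w_k^2\le\frac{\mathcal{M}(x^0)\sigma+f(x^0)-\inf f+0.5\mathcal{H}_{(2)}(\mathcal{A}+\mathcal{B})\sum_{k=0}^T\tau_k^2+\frac{\mathcal{H}_{(m+2)}\mathcal{C}}{m+2}\sum_{k=0}^T\tau_k^{m+2}}{\sum_{k=0}^T\tau_k},\]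 where $\widetilde w_k^2=\mathbb{E}\big[\|\nabla f_\sigma(x^k)\|^2/(\|x^k\|^m+1)^2\big]$, $\mathcal{M}(x)=(2^{m-1}\mathrm{R}_1\|x\|^m+\mathrm{R}_2)\sqrt d+2^{m-1}\mathrm{R}_1\sigma^m(m+1+d)^{(m+1)/2}$, and for an integer $p\ge1$, $\mathcal{H}_{(p)}=3^{p-1}\max\big\{2^{(m-1)p}\mathrm{R}_1^p(2p+d)^p,\ \mathrm{R}_2^p(2p+d)^p+2^{(m-1)p}\mathrm{R}_1^p\sigma^{mp}[(m+2)p+d]^{(m+2)p/2}\big\}$.
   Context: $\mathcal{N}(0,I)$ is the $d$-dimensional standard Gaussian distribution; $\|\cdot\|$ the Euclidean norm. $f$ is SPB with parameters $\mathrm{R}_1\ge0$, $\mathrm{R}_2>0$, integer $m\ge0$ (with $\mathrm{R}_1=0$ iff $m=0$) if $f$ is locally Lipschitz and $\sup_{\zeta\in\partial_Cf(x)}\|\zeta\|\le\mathrm{R}_1\|x\|^m+\mathrm{R}_2$ for all $x$, where $\partial_C f$ is the Clarke subdifferential (convention $0^0=1$). For such $f$, $f_\sigma$ is continuously differentiable. *)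

(* Defs.v *)
From HB Require Import structures.
From mathcomp Require Import all_boot all_order all_algebra.
From mathcomp Require Import all_classical all_reals all_analysis.
Set Implicit Arguments. Unset Strict Implicit. Unset Printing Implicit Defensive.
Import Order.TTheory GRing.Theory Num.Theory.
Import numFieldNormedType.Exports.
Local Open Scope classical_set_scope.
Local Open Scope ring_scope.

Section Defs.
Context {R : realType} {d : nat}.
Notation vec := 'rV[R]_d.

Definition dotp (a b : vec) : R := \sum_(i < d) a 0 i * b 0 i.
Definition enorm (a : vec) : R := Num.sqrt (\sum_(i < d) (a 0 i) ^+ 2).

Definition locally_lipschitz (f : vec -> R) : Prop :=
  forall x : vec, exists r : R, exists L : R, 0 < r /\
    forall y z : vec, enorm (y - x) < r -> enorm (z - x) < r ->
      `|f y - f z| <= L * enorm (y - z).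

(* Clarke generalized directional derivative condition, unfolded:
   <zeta, v> <= f°(x; v) := limsup_{y -> x, t \downarrow 0} (f(y + t v) - f(y)) / t
   i.e. for all eps, delta > 0 there are y, t with |y - x| < delta,
   0 < t < delta and (f(y + t v) - f y) / t > <zeta, v> - eps. *)
Definition clarke_subdiff (f : vec -> R) (x zeta : vec) : Prop :=
  forall v : vec, forall eps delta : R, 0 < eps -> 0 < delta ->
    exists y : vec, exists t : R,
      [/\ enorm (y - x) < delta, 0 < t, t < delta &
          dotp zeta v - eps < (f (y + t *: v) - f y) / t].

(* SPB with parameters R1, R2, m (0 ^+ 0 = 1 by convention of ^+). *)
Definition SPB (f : vec -> R) (R1 R2 : R) (m : nat) : Prop :=
  [/\ 0 <= R1, 0 < R2, (R1 = 0 <-> m = 0%N),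
      locally_lipschitz f &
      forall x zeta : vec, clarke_subdiff f x zeta ->
        enorm zeta <= R1 * enorm x ^+ m + R2].

Definition evec (i : 'I_d) : vec := delta_mx 0 i.
Definition grad (g : vec -> R) (x : vec) : vec := \row_i derive g x (evec i).
End Defs.

Section Prob.
Context {R : realType} {dT : measure_display} {T : measurableType dT}.

Definition mutually_independent {I : eqType} (P : probability T R)
    (X : I -> T -> R) : Prop :=
  forall (J : seq I) (A : I -> set R), uniq J ->
    (forall j, j \in J -> measurable (A j)) ->
    P [set w | forall j, j \in J -> A j (X j w)] =
    (\prod_(j <- J) P (X j @^-1` A j))%E.

Definition std_normal (P : probability T R) (X : T -> R) : Prop :=
  measurable_fun setT X /\
  forall A : set R, measurable A -> P (X @^-1` A) = normal_prob 0 1 A.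

Context {d : nat}.
Definition uvec (U : nat -> 'I_d -> T -> R) (k : nat) (w : T) : 'rV[R]_d :=
  \row_i U k i w.

Fixpoint iter_x (f : 'rV[R]_d -> R) (m : nat) (sigma : R) (x0 : 'rV[R]_d)
    (tau : nat -> R) (U : nat -> 'I_d -> T -> R) (k : nat) (w : T)
    : 'rV[R]_d :=
  match k with
  | 0%N => x0
  | k'.+1 =>
      let xk := iter_x f m sigma x0 tau U k' w in
      let uk := uvec U k' w in
      let vk := (sigma^-1 * (f (xk + sigma *: uk) - f xk)) *: uk in
      xk - (tau k' / (enorm xk ^+ (2 * m) + 1)) *: vk
  end.

(* Gaussian smoothing f_sigma(x) = E_{u ~ N(0,I)} [f(x + sigma u)], computed
   with any standard Gaussian vector u0 = (u0 i)_i (i.i.d. N(0,1) coordinates);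
   the value only depends on the law N(0,I). *)
Definition fsmooth (P : probability T R) (u0 : 'I_d -> T -> R)
    (f : 'rV[R]_d -> R) (sigma : R) (x : 'rV[R]_d) : R :=
  fine ('E_P[fun w => f (x + sigma *: \row_i u0 i w)]).
End Prob.

Section Constants.
Context {R : realType}.
Variables (d m : nat) (R1 R2 sigma : R).

Definition cH (p : nat) : R :=
  3 ^+ p.-1 * Num.max
    ((2:R) ^ ((m%:Z - 1) * p%:Z) * R1 ^+ p * ((2 * p + d)%:R) ^+ p)
    (R2 ^+ p * ((2 * p + d)%:R) ^+ p
     + (2:R) ^ ((m%:Z - 1) * p%:Z) * R1 ^+ p * sigma ^+ (m * p)
       * (((m + 2) * p + d)%:R) `^ (((m + 2) * p)%:R / 2)).

Definition cA : R :=
  (2:R) ^ (2 * m%:Z - 2) * R1 * sigma ^ (m%:Z - 1)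
    * ((m + 1 + d)%:R) `^ ((m + 1)%:R / 2)
  + sigma^-1 * R2 * Num.sqrt (d%:R).

Definition cB : R := (2:R) ^ (2 * m%:Z - 2) * sigma^-1 * R1 * Num.sqrt (d%:R).

Definition cC : R := (2:R) ^ (m%:Z - 1) * sigma^-1 * R1 * Num.sqrt (d%:R).

Definition cM (x : 'rV[R]_d) : R :=
  ((2:R) ^ (m%:Z - 1) * R1 * enorm x ^+ m + R2) * Num.sqrt (d%:R)
  + (2:R) ^ (m%:Z - 1) * R1 * sigma ^+ m
    * ((m + 1 + d)%:R) `^ ((m + 1)%:R / 2).
End Constants.

(* Main.v *)
Require Import Defs.
From HB Require Import structures.
From mathcomp Require Import all_boot all_order all_algebra.
From mathcomp Require Import all_classical all_reals all_analysis.
From mathcomp Require Import measurable_realfun ring lra.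
Set Implicit Arguments. Unset Strict Implicit. Unset Printing Implicit Defensive.
Import Order.TTheory GRing.Theory Num.Theory.
Import numFieldNormedType.Exports.
Local Open Scope classical_set_scope.
Local Open Scope ring_scope.

(** Let [g(x) = E[f(x + sigma u) u] / sigma].

    Hahn-Banach turns the bound on the Clarke subgradients into the mean value
    inequality [|f(x+h) - f(x)| <= (rho (|x|^m + |h|^m) + R2) |h|] with
    [rho = 2^(m-1) R1].

    All facts about the Gaussian law come from one identity: the density of
    [c u + s] with respect to the law of [u].  Combined with [e^y >= 1 + y],
    the scaling case ([c > 1], [s = 0]) gives
    [E|u|^(2p+2) <= (2p+d) E|u|^(2p)], hence all moment bounds.  The translation
    case ([c = 1]), applied to [f - inf f >= 0], gives
    [f_sigma(x+h) >= f_sigma(x) + <g(x), h> - O(|h|^2)].  Exchanging the roles of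
    [x] and [x+h] and using that [g] is locally Lipschitz gives the reverse
    inequality, so [g] is the gradient of [f_sigma]; no differentiation under
    the integral is needed.

    Integrating the Lipschitz bound on [g] along a segment gives a descent
    inequality with remainder
    [(A + B|x|^m) |h|^2 / 2 + C |h|^(m+2) / (m+2)].  For the random step [h] the
    moments of the search direction are at most [H_p (|x|^(mp) + 1)], which the
    factor [1 / (|x|^(2m) + 1)] compensates.  Since [u^k] is independent of [x^k],
    Tonelli allows averaging over [u^k] with [x^k] fixed; the resulting one-step
    inequality is telescoped. *)

(** * Euclidean space *)

(** Two features shape the argument. The inequality e^y >= 1 + y survives integration only against a
    nonnegative weight, so [f] enters through f - M with M a lower bound of [f], and every estimate
    obtained in this way is one-sided. Moreover no moment of the iterates is known beforehand. The
    one-step inequality is therefore first proved for extended-real integrals of the nonnegative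
    quantity f_sigma - M; integrability of f_sigma(x^k) and of the normalized squared gradient then
    follows from it by induction on k.

    Origin of the constants: (s + t)^m <= 2^(m-1) (s^m + t^m) is used once to isolate the increment
    |h|^m, which gives the factor of C, and a second time on |x + sigma u|^m, which gives the factor
    2^(2m-2) of A and B. The factor 3^(p-1) of H_p is the analogue for three summands. *)

Section euclidean.
Context {R : realType} {d : nat}.
Implicit Types (a b c : 'rV[R]_d) (k : R).

Lemma dotpDl a b c : dotp (a + b) c = dotp a c + dotp b c.
Proof.
by rewrite /dotp -big_split; apply: eq_bigr => i _; rewrite mxE mulrDl.
Qed.

Lemma dotpC a b : dotp a b = dotp b a.
Proof. by apply: eq_bigr => i _; rewrite mulrC. Qed.

Lemma dotpDr a b c : dotp a (b + c) = dotp a b + dotp a c.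
Proof. by rewrite dotpC dotpDl !(dotpC a). Qed.

Lemma dotpZl k a b : dotp (k *: a) b = k * dotp a b.
Proof. by rewrite /dotp mulr_sumr; apply: eq_bigr => i _; rewrite mxE mulrA. Qed.

Lemma dotpZr k a b : dotp a (k *: b) = k * dotp a b.
Proof. by rewrite dotpC dotpZl dotpC. Qed.

Lemma dotpNl a b : dotp (- a) b = - dotp a b.
Proof. by rewrite -scaleN1r dotpZl mulN1r. Qed.

Lemma dotpNr a b : dotp a (- b) = - dotp a b.
Proof. by rewrite dotpC dotpNl dotpC. Qed.

Lemma dotpBl a b c : dotp (a - b) c = dotp a c - dotp b c.
Proof. by rewrite dotpDl dotpNl. Qed.

Lemma dotp0 a : dotp a 0 = 0.
Proof. by rewrite -(scale0r 0) dotpZr mul0r. Qed.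

Lemma enorm_ge0 a : 0 <= enorm a.
Proof. exact: sqrtr_ge0. Qed.

Lemma dotp_ge0 a : 0 <= dotp a a.
Proof. by apply: sumr_ge0 => i _; rewrite -expr2 sqr_ge0. Qed.

Lemma enorm_sqr a : enorm a ^+ 2 = dotp a a.
Proof.
rewrite sqr_sqrtr; first by apply: eq_bigr => i _; rewrite expr2.
by apply: sumr_ge0 => i _; rewrite sqr_ge0.
Qed.

Lemma enorm0 : enorm (0 : 'rV[R]_d) = 0.
Proof. by apply/eqP; rewrite -sqrf_eq0 enorm_sqr dotp0. Qed.

Lemma enormZ k a : enorm (k *: a) = `|k| * enorm a.
Proof.
apply/eqP; rewrite -(@eqrXn2 _ 2)// ?enorm_ge0 ?mulr_ge0 ?enorm_ge0//.
by rewrite exprMn !enorm_sqr dotpZl dotpZr mulrA -expr2 real_normK ?num_real.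
Qed.

Lemma enormN a : enorm (- a) = enorm a.
Proof. by rewrite -scaleN1r enormZ normrN1 mul1r. Qed.

Lemma enormBC a b : enorm (a - b) = enorm (b - a).
Proof. by rewrite -enormN opprB. Qed.

Lemma dotp_le a b : dotp a b <= enorm a * enorm b.
Proof.
have [b0|b0] := eqVneq (dotp b b) 0.
  suff -> : dotp a b = 0 by rewrite mulr_ge0 ?enorm_ge0.
  apply: big1 => i _; suff -> : b 0 i = 0 by rewrite mulr0.
  apply/eqP; rewrite -sqrf_eq0 expr2.
  move/eqP: b0; rewrite psumr_eq0 => [/allP/(_ i)|j _].
    by rewrite mem_index_enum => /(_ isT).
  by rewrite -expr2 sqr_ge0.
have bb : 0 < dotp b b by rewrite lt0r b0 dotp_ge0.
rewrite (le_trans (ler_norm _))// -(@ler_pXn2r _ 2)// ?nnegrE ?mulr_ge0 ?enorm_ge0//.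
rewrite exprMn !enorm_sqr real_normK ?num_real//.
(* This vector is |b|^2 times the component of [a] orthogonal to [b]. *)
have := dotp_ge0 (dotp b b *: a - dotp a b *: b).
rewrite dotpDl !dotpDr !dotpNl !dotpNr !dotpZl !dotpZr (dotpC b a).
have -> : dotp b b * (dotp b b * dotp a a) - dotp b b * (dotp a b * dotp a b) +
  (- (dotp a b * (dotp b b * dotp a b)) - - (dotp a b * (dotp a b * dotp b b))) =
  dotp b b * (dotp a a * dotp b b - dotp a b ^+ 2) by ring.
by rewrite pmulr_rge0// subr_ge0.
Qed.

Lemma normr_dotp_le a b : `|dotp a b| <= enorm a * enorm b.
Proof. by rewrite ler_norml dotp_le andbT lerNl -dotpNl -(enormN a) dotp_le. Qed.

Lemma enormD a b : enorm (a + b) <= enorm a + enorm b.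
Proof.
rewrite -(@ler_pXn2r _ 2)// ?nnegrE ?addr_ge0 ?enorm_ge0//.
rewrite enorm_sqr dotpDl !dotpDr sqrrD !enorm_sqr (dotpC b a).
have := dotp_le a b; lra.
Qed.

Lemma enorm_le_sum a : enorm a <= \sum_i `|a 0 i|.
Proof.
rewrite -(@ler_pXn2r _ 2)// ?nnegrE ?enorm_ge0 ?sumr_ge0//.
rewrite enorm_sqr /dotp expr2 mulr_suml; apply: ler_sum => i _.
rewrite -[leLHS]ger0_norm -?expr2 ?sqr_ge0// expr2 normrM ler_wpM2l//.
by rewrite (bigD1 i)//= lerDl sumr_ge0.
Qed.

Lemma row_evec_sum a : a = \sum_i a 0 i *: evec i.
Proof. by rewrite {1}[a]row_sum_delta. Qed.

End euclidean.

(** * Clarke subgradients and the mean value inequality *)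

Section sublinear.
Context {R : realType} {d : nat}.
Implicit Types (p : 'rV[R]_d -> R) (a b v : 'rV[R]_d).

Definition sublinear p :=
  (forall a b, p (a + b) <= p a + p b) /\
  (forall k a, 0 < k -> p (k *: a) = k * p a).

Lemma sublinear0 p : sublinear p -> p 0 = 0.
Proof. by case=> _ /(_ 2 0 ltac:(lra)); rewrite scaler0; lra. Qed.

Lemma sublinearN p a : sublinear p -> - p (- a) <= p a.
Proof. by move=> sp; have := sp.1 a (- a); rewrite subrr sublinear0//; lra. Qed.

(* The largest sublinear minorant of p that is linear along v and agrees with p
   there. *)
Definition straighten p v a :=
  inf [set p (a + t *: v) - t * p v | t in [set t | 0 <= t]].

Lemma straighten_le p v a t : sublinear p -> 0 <= t ->
  straighten p v a <= p (a + t *: v) - t * p v.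
Proof.
move=> sp t0; apply: ge_inf; last by exists t.
(* The infimum needs a lower bound of the set; it comes from subadditivity applied to s v = (a + s
   v) + (-a). *)
exists (- p (- a)) => _ /= [s s0 <-].
have : s * p v <= p (a + s *: v) + p (- a).
  apply: le_trans (sp.1 _ _); rewrite addrAC subrr add0r.
  have [->|sn0] := eqVneq s 0; first by rewrite mul0r scale0r sublinear0.
  by rewrite sp.2// lt0r sn0.
lra.
Qed.

Lemma le_straighten p v a c :
  (forall t, 0 <= t -> c <= p (a + t *: v) - t * p v) -> c <= straighten p v a.
Proof.
move=> h; apply: lb_le_inf; last by move=> _ /= [t t0 <-]; exact: h.
by exists (p (a + 0 *: v) - 0 * p v), 0 => /=.
Qed.

Lemma straighten_le_id p v a : sublinear p -> straighten p v a <= p a.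
Proof.
by move=> sp; have := straighten_le v a sp (lexx 0); rewrite scale0r addr0 mul0r subr0.
Qed.

Lemma straightenN p v : sublinear p -> straighten p v (- v) <= - p v.
Proof.
move=> sp; have := straighten_le v (- v) sp ler01.
by rewrite scale1r addNr sublinear0// mul1r sub0r.
Qed.

Lemma sublinear_straighten p v : sublinear p -> sublinear (straighten p v).
Proof.
move=> sp; split=> [a b|k a k0].
  rewrite -lerBlDr; apply: le_straighten => t t0.
  rewrite lerBlDr -lerBlDl; apply: le_straighten => s s0; rewrite lerBlDl.
  apply: le_trans (straighten_le _ _ sp (addr_ge0 t0 s0)) _.
  have := sp.1 (a + t *: v) (b + s *: v).
  by rewrite addrACA -scalerDl; lra.
have scale_le l c : 0 < l -> straighten p v (l *: c) <= l * straighten p v c.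
  move=> l0; rewrite -ler_pdivrMl//; apply: le_straighten => t t0.
  rewrite ler_pdivrMl//.
  apply: le_trans (straighten_le _ _ sp (mulr_ge0 (ltW l0) t0)) _.
  by rewrite -scalerA -scalerDr sp.2//; lra.
apply/eqP; rewrite eq_le scale_le//=.
rewrite -ler_pdivlMl// (le_trans _ (scale_le _ _ _)) ?invr_gt0//.
by rewrite scalerA mulVf ?gt_eqF// scale1r.
Qed.

(** Linearity along v, once forced, survives every further decrease: if q <= straighten p v, then
    q(-v) <= -p(v) <= -q(v). So the directions can be treated one at a time. *)
Lemma sublinear_minorant p (s : seq 'rV[R]_d) : sublinear p ->
  exists2 q, sublinear q &
    (forall a, q a <= p a) /\ (forall v, v \in s -> q (- v) <= - q v).
Proof.
elim: s p => [|v s ih] p sp; first by exists p.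
have [q sq [qle qs]] := ih _ (sublinear_straighten v sp).
exists q => //; split => [a|w].
  exact: le_trans (qle _) (straighten_le_id _ _ sp).
rewrite inE => /orP[/eqP ->|]; last exact: qs.
apply: le_trans (qle _) _; apply: le_trans (straightenN _ sp) _.
by rewrite lerN2; apply: le_trans (qle _) (straighten_le_id _ _ sp).
Qed.

(** Straightening along v and then along each basis vector leaves a sublinear function that is
    linear on every axis, hence linear; induction on the basis takes the place of Zorn's lemma. *)
Lemma hahn_banach_rV p v : sublinear p ->
  exists2 z, dotp z v = p v & forall a, dotp z a <= p a.
Proof.
move=> sp.
have [q sq [qle qs]] :=
  sublinear_minorant [seq evec i | i <- enum 'I_d] (sublinear_straighten v sp).
(* The first straightening pins the value at v: q(v) >= -q(-v) >= p(v). *)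
have qv : p v <= q v.
  have := sublinearN (- v) sq; rewrite opprK.
  by have := qle (- v); have := straightenN v sp; lra.
have qe i : q (- evec i) <= - q (evec i).
  by apply: qs; apply/mapP; exists i => //; rewrite mem_enum.
have qZ k i : q (k *: evec i) <= k * q (evec i).
  have [k0|k0|->] := ltgtP k 0; last by rewrite scale0r mul0r sublinear0.
    rewrite -[k]opprK scaleNr -scalerN sq.2 ?oppr_gt0// mulNr.
    by have := qe i; nra.
  by rewrite sq.2.
have q_le a : q a <= dotp (\row_i q (evec i)) a.
  rewrite {1}[a]row_evec_sum /dotp.
  elim/big_ind2: _ => [|x x' y y' hx hy|i _].
  - by rewrite sublinear0.
  - by apply: le_trans (sq.1 _ _) _; exact: lerD.
  - by rewrite mxE mulrC; exact: qZ.
have q_ge a : dotp (\row_i q (evec i)) a <= q a.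
  by have := q_le (- a); rewrite dotpNr; have := sublinearN a sq; lra.
exists (\row_i q (evec i)) => [|a].
  apply/eqP; rewrite eq_le (le_trans qv) ?q_le// andbT.
  exact: le_trans (q_ge _) (le_trans (qle _) (straighten_le_id _ _ sp)).
exact: le_trans (q_ge _) (le_trans (qle _) (straighten_le_id _ _ sp)).
Qed.

End sublinear.

Section clarke.
Context {R : realType} {d : nat}.
Variables (f : 'rV[R]_d -> R).
Implicit Types (x y v w : 'rV[R]_d) (c t delta : R).

Definition clarke_ub x v c := exists2 delta, 0 < delta &
  forall y t, enorm (y - x) < delta -> 0 < t -> t < delta ->
    f (y + t *: v) - f y <= c * t.

(** The limsup in the Clarke generalized derivative, as the infimum of the constants that eventually
    bound the difference quotients. *)
Definition clarke_deriv x v := inf [set c | clarke_ub x v c].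

Lemma clarke_ubW x v c c' : c <= c' -> clarke_ub x v c -> clarke_ub x v c'.
Proof.
move=> cc' [r r0 h]; exists r => // y t yr t0 tr.
by apply: le_trans (h _ _ yr t0 tr) _; rewrite ler_wpM2r ?(ltW t0).
Qed.

Lemma clarke_ubD x v w c c' : clarke_ub x v c -> clarke_ub x w c' ->
  clarke_ub x (v + w) (c + c').
Proof.
move=> [r r0 h] [s s0 k].
have v0 : 0 < 1 + enorm v by have := enorm_ge0 v; lra.
exists (Num.min r (s / (1 + enorm v))); first by rewrite lt_min r0 divr_gt0.
move=> y t; rewrite !lt_min => /andP[yr ys] t0 /andP[tr ts].
have e1 := h y t yr t0 tr.
suff e2 : f (y + t *: v + t *: w) - f (y + t *: v) <= c' * t.
  by move: e2; rewrite -addrA -scalerDr; lra.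
move: ys ts; rewrite !ltr_pdivlMr// => ys ts.
apply: k => //; last by have := enorm_ge0 v; nra.
rewrite addrAC; apply: le_lt_trans (enormD _ _) _.
rewrite enormZ gtr0_norm//.
have := enorm_ge0 v; have := enorm_ge0 (y - x) => y0 v0'.
(* The larger of |y - x| and t, times 1 + |v|, is below s and dominates |y - x| + t |v|. *)
have [ey|ey] := leP (enorm (y - x)) t; last by nra.
nra.
Qed.

Lemma clarke_ubZ x v c k : 0 < k -> clarke_ub x v c -> clarke_ub x (k *: v) (k * c).
Proof.
move=> k0 [r r0 h]; exists (Num.min r (r / k)); first by rewrite lt_min r0 divr_gt0.
move=> y t; rewrite !lt_min => /andP[yr _] t0 /andP[_].
rewrite ltr_pdivlMr// => tr.
by rewrite scalerA -mulrA mulrCA (mulrC k) h// mulr_gt0.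
Qed.

Hypothesis fL : locally_lipschitz f.

(** Makes the set of bounds nonempty and bounded below, so that [clarke_deriv] is a genuine infimum
    and not a default value. *)
Lemma clarke_ub_bounded x v : exists2 L, clarke_ub x v L &
  forall c, clarke_ub x v c -> - L <= c.
Proof.
have [r [L [r0 h]]] := fL x.
have v0 : 0 < 1 + enorm v by have := enorm_ge0 v; lra.
have hv y t : enorm (y - x) < r / 2 -> 0 < t -> t < r / (2 * (1 + enorm v)) ->
    `|f (y + t *: v) - f y| <= (L * enorm v) * t.
  move=> yr t0; rewrite invfM mulrA ltr_pdivlMr// => tr.
  have := h (y + t *: v) y; rewrite (addrC y) addrK enormZ (gtr0_norm t0).
  rewrite -mulrA (mulrC (enorm v)); apply; last by lra.
  rewrite -addrA; apply: le_lt_trans (enormD _ _) _; rewrite enormZ gtr0_norm//.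
  by have := enorm_ge0 v; nra.
have r'0 : 0 < Num.min (r / 2) (r / (2 * (1 + enorm v))).
  by rewrite lt_min !divr_gt0// mulr_gt0.
exists (L * enorm v).
  exists (Num.min (r / 2) (r / (2 * (1 + enorm v)))) => // y t.
  rewrite !lt_min => /andP[yr _] t0 /andP[_ tr].
  exact: le_trans (ler_norm _) (hv _ _ yr t0 tr).
move=> c [s s0 k].
pose t := Num.min s (Num.min (r / 2) (r / (2 * (1 + enorm v)))) / 2.
have m0 : 0 < Num.min s (Num.min (r / 2) (r / (2 * (1 + enorm v)))).
  by rewrite lt_min s0.
have t0 : 0 < t by rewrite divr_gt0.
have : t < Num.min s (Num.min (r / 2) (r / (2 * (1 + enorm v)))).
  by rewrite ltr_pdivrMr//; lra.
rewrite !lt_min => /and3P[ts tr tr'].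
have e1 := k x t; rewrite subrr enorm0 in e1.
have {}e1 := e1 s0 t0 ts.
have := hv x t; rewrite subrr enorm0 divr_gt0// => /(_ isT t0 tr').
rewrite ler_norml => /andP[e2 _]; nra.
Qed.

Lemma clarke_deriv_le x v c : clarke_ub x v c -> clarke_deriv x v <= c.
Proof.
move=> h; apply: ge_inf => //; have [L _ hL] := clarke_ub_bounded x v.
by exists (- L) => c' /= /hL.
Qed.

Lemma clarke_deriv_ub x v e : 0 < e -> clarke_ub x v (clarke_deriv x v + e).
Proof.
move=> e0; have [L h hL] := clarke_ub_bounded x v.
have hi : has_inf [set c | clarke_ub x v c].
  by split; [exists L|exists (- L) => c /hL].
have [c hc ce] := inf_adherent e0 hi.
exact: clarke_ubW (ltW ce) hc.
Qed.

Lemma sublinear_clarke_deriv x : sublinear (clarke_deriv x).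
Proof.
split=> [v w|k v k0].
  apply/ler_addgt0Pr => e e0.
  have e20 : 0 < e / 2 by rewrite divr_gt0.
  have := clarke_ubD (clarke_deriv_ub x v e20) (clarke_deriv_ub x w e20).
  by move=> /clarke_deriv_le; lra.
have scale_le l w : 0 < l -> clarke_deriv x (l *: w) <= l * clarke_deriv x w.
  move=> l0; apply/ler_addgt0Pr => e e0.
  have el : 0 < e / l by rewrite divr_gt0.
  have := clarke_ubZ l0 (clarke_deriv_ub x w el) => /clarke_deriv_le.
  by rewrite mulrDr mulrCA divff ?gt_eqF// mulr1.
apply/eqP; rewrite eq_le scale_le//= -ler_pdivlMl//.
rewrite (le_trans _ (scale_le _ _ _)) ?invr_gt0//.
by rewrite scalerA mulVf ?gt_eqF// scale1r.
Qed.

(* By Hahn-Banach the Clarke derivative in direction v is attained by a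
   subgradient. *)
Lemma clarke_ub_subdiff x v r e : 0 < e ->
  (forall z, clarke_subdiff f x z -> enorm z <= r) ->
  clarke_ub x v (r * enorm v + e).
Proof.
move=> e0 hr; have [z zv zle] := hahn_banach_rV v (sublinear_clarke_deriv x).
apply: clarke_ubW (clarke_deriv_ub x v e0); rewrite lerD2r -zv.
apply: le_trans (dotp_le _ _) _; rewrite ler_wpM2r ?enorm_ge0//.
(* If z failed the subgradient condition in direction w, all nearby quotients would be at most <z,
   w> - eps, and so would the Clarke derivative, which dominates <z, w>. *)
apply: hr => w eps delta eps0 delta0; apply: contrapT => hn.
have : clarke_deriv x w <= dotp z w - eps.
  apply: clarke_deriv_le; exists delta => // y t yd t0 td.
  rewrite leNgt; apply/negP => ht; apply: hn; exists y, t; split => //.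
  by rewrite ltr_pdivlMr.
by have := zle w; lra.
Qed.

(** Continuation along the segment with slope c slightly above K |v|. Since [clarke_ub] is uniform
    in the base point near x + (sup S) v, one can step past sup S from a nearby member of S;
    membership of sup S itself is never at issue. *)
Lemma clarke_mean_value x v K :
  (forall s, 0 <= s <= 1 -> forall z, clarke_subdiff f (x + s *: v) z -> enorm z <= K) ->
  f (x + v) - f x <= K * enorm v.
Proof.
move=> hK; apply/ler_addgt0Pr => e e0; set c := K * enorm v + e.
pose S := [set s : R | 0 <= s <= 1 /\ f (x + s *: v) - f x <= c * s].
have S0 : S 0 by split; [rewrite lexx ler01|rewrite scale0r addr0 subrr mulr0].
have hS : has_sup S by split; [exists 0|exists 1 => s [/andP[]]].
have s0 : 0 <= sup S by apply: sup_upper_bound.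
have s1 : sup S <= 1 by apply: ge_sup; [exists 0|move=> s [/andP[]]].
have [r r0 h] := clarke_ub_subdiff v e0 (hK _ (introT andP (conj s0 s1))).
have v0 : 0 < 2 * (1 + enorm v) by have := enorm_ge0 v; lra.
pose eta := r / (2 * (1 + enorm v)).
have eta0 : 0 < eta by rewrite divr_gt0.
have etav : eta * (2 * (1 + enorm v)) = r by rewrite mulfVK// gt_eqF.
have [a [a01 Sa] ea] := sup_adherent eta0 hS.
have as_ : a <= sup S by apply: sup_upper_bound.
pose b := Num.min 1 (sup S + eta).
have Sb : S b.
  have b0 : 0 <= b <= 1 by rewrite le_min ler01 ge_min lexx addr_ge0//= ltW.
  have ab : a <= b by rewrite le_min; apply/andP; split; lra.
  split => //; have [->//|nab] := eqVneq b a.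
  have := h (x + a *: v) (b - a).
  rewrite opprD addrACA subrr add0r -scalerBl enormZ.
  rewrite -(addrA x) -scalerDl (addrC a (b - a)) subrK.
  have hb : b <= sup S + eta by rewrite ge_min lexx orbT.
  have e1 : `|a - sup S| * enorm v < r.
    by rewrite ler0_norm; have := enorm_ge0 v; nra.
  have e2 : 0 < b - a by rewrite subr_gt0 lt_neqAle eq_sym nab.
  move=> /(_ e1 e2); have : b - a < r by have := enorm_ge0 v; nra.
  by move=> e3 /(_ e3); rewrite -/c; nra.
have : b <= sup S by apply: sup_upper_bound.
rewrite /b ge_min; case/orP => [s1'|]; last by lra.
have b1 : b = 1 by rewrite /b; apply/min_idPl; lra.
by have [_] := Sb; rewrite b1 scale1r mulr1.
Qed.

End clarke.

(** * Polynomial growth of the increments of f *)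

Section growth.
Context {R : realType}.

Lemma subr_expr_mulr_ge0 (s t : R) n : 0 <= s -> 0 <= t ->
  0 <= (s ^+ n - t ^+ n) * (s - t).
Proof.
move=> s0 t0; have [st|ts] := leP s t.
  by rewrite mulr_le0// subr_le0// lerXn2r.
by rewrite mulr_ge0// subr_ge0 ?lerXn2r ?(ltW ts).
Qed.

(** The induction step is (s^k + t^k)(s + t) <= 2 (s^(k+1) + t^(k+1)), which rearranges to (s^k -
    t^k)(s - t) >= 0. *)
Lemma exprD_convex (s t : R) n : 0 <= s -> 0 <= t ->
  (s + t) ^+ n.+1 <= 2 ^+ n * (s ^+ n.+1 + t ^+ n.+1).
Proof.
move=> s0 t0; elim: n => [|n ih]; first by rewrite !expr1 expr0 mul1r.
rewrite exprSr; apply: le_trans (ler_wpM2r (addr_ge0 s0 t0) ih) _.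
rewrite (exprSr 2 n) -!mulrA ler_wpM2l ?exprn_ge0//.
have := subr_expr_mulr_ge0 n.+1 s0 t0.
by rewrite (exprSr s n.+1) (exprSr t n.+1); lra.
Qed.

Lemma expr3_convex (a b c : R) n : 0 <= a -> 0 <= b -> 0 <= c ->
  (a + b + c) ^+ n.+1 <= 3 ^+ n * (a ^+ n.+1 + b ^+ n.+1 + c ^+ n.+1).
Proof.
move=> a0 b0 c0; elim: n => [|n ih]; first by rewrite !expr1 expr0 mul1r.
rewrite exprSr; apply: le_trans (ler_wpM2r (addr_ge0 (addr_ge0 a0 b0) c0) ih) _.
rewrite (exprSr 3 n) -!mulrA ler_wpM2l ?exprn_ge0//.
have := subr_expr_mulr_ge0 n.+1 a0 b0; have := subr_expr_mulr_ge0 n.+1 a0 c0.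
have := subr_expr_mulr_ge0 n.+1 b0 c0.
by rewrite (exprSr a n.+1) (exprSr b n.+1) (exprSr c n.+1); lra.
Qed.

Variables (d m : nat) (f : 'rV[R]_d -> R) (R1 R2 : R).
Hypothesis fspb : SPB f R1 R2 m.

Local Notation rho := ((2 : R) ^ (m%:Z - 1) * R1).

Lemma SPB_R1_ge0 : 0 <= R1. Proof. by case: fspb. Qed.

Lemma SPB_R2_gt0 : 0 < R2. Proof. by case: fspb. Qed.

Lemma SPB_rho_ge0 : 0 <= rho.
Proof. by rewrite mulr_ge0 ?SPB_R1_ge0// exprz_ge0. Qed.

Lemma SPB_exprD (s t : R) : 0 <= s -> 0 <= t ->
  R1 * (s + t) ^+ m <= rho * (s ^+ m + t ^+ m).
Proof.
move=> s0 t0; have [R1ge _ R1m _ _] := fspb.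
(* For m = 0 the power of 2 has exponent -1; there R1 = 0 and both sides vanish. *)
case: m R1m => [[_ /(_ erefl) ->]|n _]; first by rewrite mulr0 !mul0r.
have -> : (2 : R) ^ (n.+1%:Z - 1) = 2 ^+ n.
  by rewrite intS addrC addKr.
by rewrite [2 ^+ n * R1]mulrC -mulrA ler_wpM2l// exprD_convex.
Qed.

Lemma SPB_growth (x h : 'rV[R]_d) :
  `|f (x + h) - f x| <= (rho * (enorm x ^+ m + enorm h ^+ m) + R2) * enorm h.
Proof.
have [R1ge _ R1m fL fC] := fspb.
have bnd s : 0 <= s <= 1 -> forall z, clarke_subdiff f (x + s *: h) z ->
    enorm z <= rho * (enorm x ^+ m + enorm h ^+ m) + R2.
  move=> /andP[s0 s1] z /fC hz; apply: le_trans hz _; rewrite lerD2r.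
  apply: le_trans (SPB_exprD (enorm_ge0 x) (enorm_ge0 h)).
  rewrite ler_wpM2l// lerXn2r// ?nnegrE ?addr_ge0 ?enorm_ge0//.
  apply: le_trans (enormD _ _) _; rewrite lerD2l enormZ ger0_norm//.
  by rewrite ler_piMl// enorm_ge0.
(* The mean value inequality is one-sided; the other sign comes from traversing the same segment
   backwards, s becoming 1 - s. *)
rewrite ler_norml (clarke_mean_value fL bnd) andbT lerNl opprB.
have := @clarke_mean_value _ _ f fL (x + h) (- h) (rho * (enorm x ^+ m + enorm h ^+ m) +
  R2).
rewrite addrK enormN; apply => s /andP[s0 s1] z.
have -> : x + h + s *: - h = x + (1 - s) *: h.
  by rewrite scalerBl scale1r scalerN addrA.
by apply: bnd; rewrite subr_ge0 s1 gerBl.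
Qed.

End growth.

(** * Measurability and independence *)

Section measurability.
Context {R : realType} {d : nat}.

(** Continuity with respect to the Euclidean norm, in which all the estimates are expressed. *)
Definition econt (f : 'rV[R]_d -> R) := forall x e, 0 < e ->
  exists2 r, 0 < r & forall y, enorm (y - x) < r -> `|f y - f x| < e.

(* Measurability for the product sigma-algebra, which 'rV[R]_d does not carry
   in the library. *)
Definition vmeas (f : 'rV[R]_d -> R) :=
  forall (dS : measure_display) (S : measurableType dS) (X : 'I_d -> S -> R),
    (forall i, measurable_fun setT (X i)) ->
    measurable_fun setT (fun s => f (\row_i X i s)).

Lemma measurable_forall_ord dS (S : measurableType dS) n (F : 'I_n -> set S) :
  (forall i, measurable (F i)) -> measurable [set s | forall i, F i s].
Proof.
move=> mF; have -> : [set s | forall i, F i s] = \bigcap_i F i.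
  by apply/seteqP; split => s /= h i //; exact: h.
exact: fin_bigcap_measurable.
Qed.

(* A continuous function is the limit of its values at grid points. *)
Lemma econt_vmeas f : econt f -> vmeas f.
Proof.
move=> cf dS S X mX.
pose g n (z : {ffun 'I_d -> int}) : R := f (\row_i ((z i)%:~R / n.+1%:R)).
pose Z n s : {ffun 'I_d -> int} := [ffun i => Num.floor (n.+1%:R * X i s)].
apply: (@measurable_fun_cvg _ _ _ _ (fun n s => g n (Z n s))) => [n|s _].
  move=> _ B mB; rewrite setTI.
  (* [Z n] has countably many values, so the preimage is a countable union of grid cells. *)
  have -> : (fun s => g n (Z n s)) @^-1` B = \bigcup_(z : {ffun 'I_d -> int})
      ([set s | forall i, Num.floor (n.+1%:R * X i s) = z i] `&` [set _ | B (g n z)]).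
    apply/seteqP; split => s /=.
      by move=> Bs; exists (Z n s) => //; split => // i; rewrite ffunE.
    move=> [z _ /= [sz Bz]]; suff -> : Z n s = z by [].
    by apply/ffunP => i; rewrite ffunE.
  apply: countable_bigcupT_measurable; first exact: countableP.
  move=> z; apply: measurableI; last first.
    have [h|h] := pselect (B (g n z)).
      by rewrite (_ : [set _ | _] = setT)//; apply/seteqP; split.
    by rewrite (_ : [set _ | _] = set0)//; apply/seteqP; split.
  apply: measurable_forall_ord => i.
  have mY : measurable_fun setT (fun s => n.+1%:R * X i s).
    exact: measurable_funM.
  rewrite [X in measurable X](_ : _ =
      (fun s => n.+1%:R * X i s) @^-1` `[(z i)%:~R, (z i + 1)%:~R[); last first.
    apply/seteqP; split => s /=; rewrite in_itv/=.
      by move=> <-; rewrite floor_le_tmp floorD1_gt.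
    by move=> /floor_def.
  by rewrite -[X in measurable X]setTI; exact: mY.
apply/cvgrPdist_lt => e e0.
have [r r0 hr] := cf (\row_i X i s) e e0.
have [N hN] : exists N : nat, d%:R / r < N%:R :> R.
  by exists (Num.truncn (d%:R / r)).+1; rewrite truncnS_gt.
near=> n; rewrite distrC; apply: hr.
apply: le_lt_trans (enorm_le_sum _) _.
have n0 : 0 < n.+1%:R :> R by [].
apply: (@le_lt_trans _ _ (\sum_(i < d) n.+1%:R^-1)).
  apply: ler_sum => i _; rewrite !mxE ffunE ler0_norm.
    rewrite opprB lerBlDr -[X in X + _]mul1r -mulrDl ler_pdivlMr//.
    by have := floorD1_gt (n.+1%:R * X i s); rewrite intrD mulrC addrC => /ltW.
  by rewrite subr_le0 ler_pdivrMr// mulrC floor_le_tmp.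
rewrite sumr_const card_ord -[_ *+ _]mulr_natr mulrC ltr_pdivrMr// mulrC.
rewrite -ltr_pdivrMr//; apply: lt_le_trans hN _; rewrite ler_nat.
by apply: leqW; near: n; exact: nbhs_infty_ge.
Unshelve. all: by end_near. Qed.

Lemma vmeas_comp g (F : 'rV[R]_d -> 'rV[R]_d) : vmeas g ->
  (forall i, vmeas (fun a => F a 0 i)) -> vmeas (g \o F).
Proof.
move=> mg mF dS S X mX.
rewrite [X in measurable_fun _ X](_ : _ = fun s => g (\row_i F (\row_j X j s) 0 i)).
  by apply: mg => i; exact: mF.
by apply/funext => s /=; congr g; apply/rowP => i; rewrite mxE.
Qed.

Lemma vmeas_coord i : vmeas (fun a => a 0 i).
Proof.
move=> dS S X mX; rewrite [X in measurable_fun _ X](_ : _ = X i)//.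
by apply/funext => s; rewrite mxE.
Qed.

Lemma vmeas_cst (c : R) : vmeas (fun=> c).
Proof. by move=> dS S X mX; exact: measurable_cst. Qed.

Lemma vmeasD f g : vmeas f -> vmeas g -> vmeas (fun a => f a + g a).
Proof. by move=> mf mg dS S X mX; apply: measurable_funD; [exact: mf|exact: mg]. Qed.

Lemma vmeasB f g : vmeas f -> vmeas g -> vmeas (fun a => f a - g a).
Proof. by move=> mf mg dS S X mX; apply: measurable_funB; [exact: mf|exact: mg]. Qed.

Lemma vmeasM f g : vmeas f -> vmeas g -> vmeas (fun a => f a * g a).
Proof. by move=> mf mg dS S X mX; apply: measurable_funM; [exact: mf|exact: mg]. Qed.

Lemma vmeasX f n : vmeas f -> vmeas (fun a => f a ^+ n).
Proof. by move=> mf dS S X mX; apply: measurable_funX; exact: mf. Qed.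

Lemma vmeas_fun (h : R -> R) f : measurable_fun setT h -> vmeas f ->
  vmeas (fun a => h (f a)).
Proof. by move=> mh mf dS S X mX; apply: (measurableT_comp mh); exact: mf. Qed.

(** Positivity allows 1/g to be written as exp(-ln g). *)
Lemma vmeasV g : vmeas g ->
  (forall a, 0 < g a) -> vmeas (fun a => (g a)^-1).
Proof.
move=> mg g0; rewrite (_ : (fun a => _) = fun a => expR (0 - ln (g a))).
  apply: vmeas_fun; first exact: measurable_expR.
  by apply: vmeasB (vmeas_cst _) _; apply: vmeas_fun mg; exact: measurable_ln.
by apply/funext => a; rewrite sub0r expRN lnK ?posrE.
Qed.

Lemma vmeas_measurable g dS (S : measurableType dS) (F : S -> 'rV[R]_d) : vmeas g ->
  (forall i, measurable_fun setT (fun s => F s 0 i)) ->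
  measurable_fun setT (fun s => g (F s)).
Proof.
move=> mg mF; rewrite (_ : (fun s => _) = fun s => g (\row_i F s 0 i)); first exact: mg.
by apply/funext => s; congr g; apply/rowP => i; rewrite mxE.
Qed.

Lemma econt_enorm : econt (@enorm R d).
Proof.
move=> x e e0; exists e => // y; apply: le_lt_trans.
have := enormD (y - x) x; have := enormD (x - y) y; rewrite !subrK (enormBC x).
by rewrite ler_norml => *; apply/andP; split; lra.
Qed.

Lemma econt_dotp b : econt (fun a => dotp a b).
Proof.
move=> x e e0; have b0 : 0 < 1 + enorm b by have := enorm_ge0 b; lra.
exists (e / (1 + enorm b)); first by rewrite divr_gt0.
move=> y; rewrite ltr_pdivlMr// -dotpBl => h.
apply: le_lt_trans (normr_dotp_le _ _) _.
by have := enorm_ge0 (y - x); nra.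
Qed.

End measurability.

(** * Finite cylinders, independence and Tonelli *)

Section cylinders.
Context {R : realType} {T : pointedType} {I : eqType} (X : I -> T -> R).

(** A pi-system generating the sigma-algebra of the variables X_j with j in J. Equipping the sample
    space with that sigma-algebra turns dependence on these variables alone into measurability. *)
Definition cylinders (J : seq I) : set (set T) :=
  [set E | exists2 A : I -> set R, (forall j, measurable (A j)) &
           E = [set w | forall j, j \in J -> A j (X j w)]].

Lemma cylinders_setI J : setI_closed (cylinders J).
Proof.
move=> _ _ [A mA ->] [B mB ->]; exists (fun j => A j `&` B j) => [j|].
  exact: measurableI.
apply/seteqP; split => w /= => [[h k] j jJ|h]; first by split; [exact: h|exact: k].
by split => j jJ; have [] := h j jJ.
Qed.

Lemma cylinders_setT J : cylinders J setT.
Proof. by exists (fun=> setT) => //; apply/seteqP; split. Qed.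

Lemma measurable_cylinder dS (S : measurableType dS) (Y : I -> S -> R)
    (J : seq I) (A : I -> set R) :
  (forall j, measurable (A j)) -> (forall j, j \in J -> measurable_fun setT (Y j)) ->
  measurable [set w | forall j, j \in J -> A j (Y j w)].
Proof.
move=> mA; elim: J => [|i J ih] mY.
  by rewrite (_ : [set _ | _] = setT)//; apply/seteqP; split.
have -> : [set w | forall j, j \in i :: J -> A j (Y j w)] =
    Y i @^-1` A i `&` [set w | forall j, j \in J -> A j (Y j w)].
  apply/seteqP; split => w /= => [h|[h k] j].
    by split => [|j jJ]; apply: h; rewrite inE ?eqxx// jJ orbT.
  by rewrite inE => /orP[/eqP->//|]; exact: k.
apply: measurableI; last by apply: ih => j jJ; apply: mY; rewrite inE jJ orbT.
by rewrite -[X in measurable X]setTI; apply: mY; rewrite ?inE ?eqxx.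
Qed.

Lemma measurable_cylinders_coord J j : j \in J ->
  measurable_fun setT (X j : g_sigma_algebraType (cylinders J) -> R).
Proof.
move=> jJ _ A mA; rewrite setTI; apply: sub_sigma_algebra.
exists (fun i => if i == j then A else setT) => [i|]; first by case: ifP.
apply/seteqP; split => w /= => [h i _|/(_ j jJ)]; last by rewrite eqxx.
by case: eqP => // ->.
Qed.

End cylinders.

Section independence.
Context {R : realType} {dT : measure_display} {T : measurableType dT}.
Context (P : probability T R) {I : eqType} (X : I -> T -> R).
Local Notation cylinders := (cylinders X).

Hypothesis mX : forall j, measurable_fun setT (X j).

Lemma cylinders_measurable J : cylinders J `<=` measurable.
Proof. by move=> _ [A mA ->]; exact: measurable_cylinder. Qed.

Lemma sigma_cylinders_measurable J : <<s cylinders J >> `<=` @measurable _ T.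
Proof.
apply: smallest_sub; first exact: sigma_algebra_measurable.
exact: cylinders_measurable.
Qed.

Hypothesis indX : mutually_independent P X.

Lemma indep_cylinders (J1 J2 : seq I) E F : ~~ has (mem J1) J2 ->
  cylinders J1 E -> cylinders J2 F -> P (E `&` F) = (P E * P F)%E.
Proof.
move=> J12 [A mA ->] [B mB ->].
(* [mutually_independent] speaks of duplicate-free lists; without repetitions the two disjoint lists
   concatenate to such a list. *)
have undupE J (C : I -> set R) : [set w | forall j, j \in J -> C j (X j w)] =
    [set w | forall j, j \in undup J -> C j (X j w)].
  by apply/seteqP; split => w /= h j jJ; apply: h; rewrite ?mem_undup// -mem_undup.
rewrite (undupE J1) (undupE J2).
pose C j := if j \in J1 then A j else B j.
have mC j : measurable (C j) by rewrite /C; case: ifP.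
have nJ j : j \in J2 -> j \notin J1.
  by move=> jJ2; apply: contra J12 => jJ1; apply/hasP; exists j.
have -> : [set w | forall j, j \in undup J1 -> A j (X j w)] `&`
    [set w | forall j, j \in undup J2 -> B j (X j w)] =
    [set w | forall j, j \in undup J1 ++ undup J2 -> C j (X j w)].
  apply/seteqP; split => w /= => [[h k] j|h].
    rewrite mem_cat !mem_undup /C; case: ifP => [jJ1 _|_ /= jJ2].
      by apply: h; rewrite mem_undup.
    by apply: k; rewrite mem_undup.
  split => j jJ; have := h j; rewrite mem_cat jJ ?orbT => /(_ isT); rewrite /C.
    by rewrite -(mem_undup J1) jJ.
  by rewrite (negbTE (nJ j _))// -mem_undup.
rewrite !indX ?undup_uniq// ?cat_uniq ?undup_uniq//= ?andbT; last first.
  by apply: contra J12 => /hasP[j]; rewrite mem_undup => h /= /[!mem_undup] k;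
    apply/hasP; exists j.
rewrite big_cat/=; congr (_ * _)%E; apply: eq_big_seq => j; rewrite mem_undup /C.
  by move=> ->.
by move=> /nJ/negbTE ->.
Qed.

(** For fixed E, both P(E & .) and P(E) P(.) are finite measures, and they agree on a pi-system.
    Only one side is enlarged and [D1] is arbitrary, so a second application with the roles
    exchanged handles the other side. *)
Lemma indep_sigma_right (D1 D2 : set (set T)) :
  D1 `<=` measurable -> D2 `<=` measurable -> setI_closed D2 -> D2 setT ->
  (forall E F, D1 E -> D2 F -> P (E `&` F) = (P E * P F)%E) ->
  forall E F, D1 E -> <<s D2 >> F -> P (E `&` F) = (P E * P F)%E.
Proof.
move=> mD1 mD2 D2I D2T h E F D1E sF.
have mE := mD1 _ D1E.
have PE : P E \is a fin_num by exact: fin_num_measure.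
have PE0 : 0 <= fine (P E) by rewrite fine_ge0.
have cov : \bigcup_(k : nat) [set: T] = setT by rewrite bigcup_const//; exists 0%N.
have := @g_sigma_algebra_measure_unique _ _ _ D2 mD2 (fun=> setT) (fun=> D2T)
  cov (mrestr P mE) (mscale (NngNum PE0) P) D2I.
have mscaleE A : mscale (NngNum PE0) P A = (P E * P A)%E.
  by rewrite -[in RHS](fineK PE).
have mrestrE A : mrestr P mE A = P (E `&` A) by rewrite setIC.
move=> /(_ _ _ F sF); rewrite -mscaleE -mrestrE; apply => [A D2A|_].
  by rewrite [LHS]mrestrE [RHS]mscaleE h.
by rewrite [ltLHS]mrestrE setIT -ge0_fin_numE.
Qed.

Lemma indep_sigma_cylinders (J1 J2 : seq I) E F : ~~ has (mem J1) J2 ->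
  <<s cylinders J1 >> E -> <<s cylinders J2 >> F -> P (E `&` F) = (P E * P F)%E.
Proof.
move=> J12 sE sF; rewrite setIC muleC.
apply: (@indep_sigma_right _ (cylinders J1) (@sigma_cylinders_measurable J2)) => //.
- exact: cylinders_measurable.
- exact: cylinders_setI.
- exact: cylinders_setT.
move=> {sE sF}F {}E sF sE; rewrite setIC muleC.
apply: (@indep_sigma_right _ (cylinders J2) (@cylinders_measurable J1)) sE sF.
- exact: cylinders_measurable.
- exact: cylinders_setI.
- exact: cylinders_setT.
- by move=> *; exact: indep_cylinders J12 _ _.
Qed.

(** The sample space is given two sigma-algebras, and w -> (w, w) maps it into their product.
    Independence says that the image of P is a product measure, so integrating on the diagonal is
    integrating the two arguments separately. *)
Lemma indep_tonelli (J1 J2 : seq I) (g : T -> T -> \bar R) : ~~ has (mem J1) J2 ->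
  (forall w w', 0 <= g w w')%E ->
  measurable_fun setT (fun z : g_sigma_algebraType (cylinders J1) *
                               g_sigma_algebraType (cylinders J2) => g z.1 z.2) ->
  measurable_fun setT (fun w => \int[P]_w' g w w')%E /\
  (\int[P]_w g w w = \int[P]_w \int[P]_w' g w w')%E.
Proof.
move=> J12 g0 mg.
have mid J : measurable_fun setT (id : T -> g_sigma_algebraType (cylinders J)).
  by move=> _ A sA; rewrite setTI; apply: (@sigma_cylinders_measurable J); exact: sA.
pose T1 := g_sigma_algebraType (cylinders J1).
pose T2 := g_sigma_algebraType (cylinders J2).
pose X1 : {mfun T >-> T1} := HB.pack (id : T -> T1) (isMeasurableFun.Build _ _ _ _ _ (mid
  J1)).
pose X2 : {mfun T >-> T2} := HB.pack (id : T -> T2) (isMeasurableFun.Build _ _ _ _ _ (mid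
  J2)).
have mdiag : measurable_fun setT ((fun w => (w, w)) : T -> T1 * T2).
  by apply: measurable_fun_pair; exact: mid.
pose D : {mfun T >-> (T1 * T2)%type} := HB.pack ((fun w => (w, w)) : T -> T1 * T2)
  (isMeasurableFun.Build _ _ _ _ _ mdiag).
have FE : fubini_F (distribution P X2) (fun z : T1 * T2 => g z.1 z.2) =
    (fun w => \int[P]_w' g w w')%E.
  apply/funext => w; rewrite /fubini_F ge0_integral_distribution//=.
  exact: (measurableT_comp mg (@measurable_pair1 _ _ T1 T2 w)).
have mF : measurable_fun setT ((fun w => \int[P]_w' g w w')%E : T1 -> \bar R).
  by rewrite -FE; exact: measurable_fun_fubini_tonelli_F.
split; first exact: (measurableT_comp mF (mid J1)).
transitivity (\int[distribution P D]_z g z.1 z.2)%E.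
  by rewrite ge0_integral_distribution.
(* Equality on measurable rectangles is exactly the factorization of P(B & C). *)
transitivity (\int[(distribution P X1 \x distribution P X2)%E]_z g z.1 z.2)%E.
  apply: eq_measure_integral => A mA _; apply/esym.
  apply: product_measure_unique => // B C mB mC.
  exact: (indep_sigma_cylinders J12 mB mC).
rewrite fubini_tonelli1//= FE ge0_integral_distribution//=.
by move=> x; exact: integral_ge0.
Qed.

Lemma indep_integral (J1 J2 : seq I) (g : T -> T -> \bar R) : ~~ has (mem J1) J2 ->
  (forall w w', 0 <= g w w')%E ->
  measurable_fun setT (fun z : g_sigma_algebraType (cylinders J1) *
                               g_sigma_algebraType (cylinders J2) => g z.1 z.2) ->
  (\int[P]_w g w w = \int[P]_w \int[P]_w' g w w')%E.
Proof. by move=> J12 g0 /(indep_tonelli J12 g0)[]. Qed.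

End independence.

(** * Gaussian change of variables *)

Section gauss1.
Context {R : realType}.
Local Notation mu := (@lebesgue_measure R).

Lemma lebesgue_measure_affine (c s : R) (c0 : 0 < c) (A : set R) : measurable A ->
  mu A = (c%:E * mu ((fun x => (c * x + s)%R) @^-1` A))%E.
Proof.
move=> mA.
have maff : measurable_fun setT ((fun x => c * x + s) : R -> measurableTypeR R).
  by apply: measurable_funD => //; exact: measurable_funM.
apply: (@lebesgue_measure_unique _ (mscale (NngNum (ltW c0)) (pushforward mu
  ((fun x => c * x + s) : R -> measurableTypeR R)))) => //= _ [[a b]] _ <-.
rewrite /mscale /pushforward/=.
rewrite [X in _ = (_ * X)%E](_ : _ = mu `](a - s) / c, (b - s) / c]); last first.
  congr (mu _); apply/seteqP; split => x /=; rewrite !in_itv/= ltr_pdivrMr// ler_pdivlMr//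
    ltrBlDr lerBrDr (mulrC x c) => //.
rewrite !lebesgue_measure_itv/= !lte_fin ltr_pM2r ?invr_gt0// ltrD2r.
case: ifP => _; last by rewrite mule0.
rewrite -!EFinB -EFinM; congr (_%:E).
by field; rewrite gt_eqF.
Qed.

Lemma ge0_integral_affine (c s : R) (h : R -> \bar R) : 0 < c ->
  measurable_fun setT h -> (forall x, 0 <= h x)%E ->
  (\int[mu]_x h x = c%:E * \int[mu]_x h (c * x + s)%R)%E.
Proof.
move=> c0 mh h0.
have maff : measurable_fun setT
    ((fun x : R => c * x + s) : measurableTypeR R -> measurableTypeR R).
  by apply: measurable_funD => //; exact: measurable_funM.
have := ge0_integral_pushforward maff mu measurableT mh (fun x _ => h0 x).
rewrite preimage_setT /= => <-.
apply: etrans (ge0_integral_mscale _ measurableT (NngNum (ltW c0))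
  (mh : measurable_fun (setT : set (measurableTypeR R)) h) (fun x _ => h0 x)).
by apply: eq_measure_integral => A mA _; exact: lebesgue_measure_affine.
Qed.

(** The Radon-Nikodym derivative and the explicit density have the same integral over every
    measurable set, hence agree almost everywhere. *)
Lemma ge0_integral_normal (h : R -> \bar R) :
  measurable_fun setT h -> (forall x, 0 <= h x)%E ->
  (\int[normal_prob 0 1]_x h x = \int[mu]_x (h x * (normal_pdf 0 1 x)%:E))%E.
Proof.
move=> mh h0.
have dom := @normal_prob_dominates R 0 1.
rewrite -(Radon_Nikodym_SigmaFinite.change_of_variables dom h0 measurableT mh).
have mRN := measurable_int _ (Radon_Nikodym_SigmaFinite.f_integrable dom).
have mpdf : measurable_fun [set: R] (fun x => (normal_pdf 0 1 x)%:E).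
  by apply/measurable_EFinP; exact: measurable_normal_pdf.
apply: ae_eq_integral => //; [exact: emeasurable_funM|exact: emeasurable_funM|].
apply: ae_eqe_mul2l; apply: integral_ae_eq => //.
  exact: Radon_Nikodym_SigmaFinite.f_integrable.
by move=> E _ mE; rewrite -Radon_Nikodym_SigmaFinite.f_integral.
Qed.

(* Density of c U + s with respect to the law of U ~ N(0, 1). *)
Definition gdens (c s y : R) : R :=
  c^-1 * expR (y ^+ 2 / 2 - ((y - s) / c) ^+ 2 / 2).

Lemma gdens_ge0 c s y : 0 < c -> 0 <= gdens c s y.
Proof. by move=> c0; rewrite mulr_ge0 ?expR_ge0// invr_ge0 ltW. Qed.

Lemma measurable_gdens c s : measurable_fun setT (gdens c s).
Proof.
apply: measurable_funM => //; apply: measurableT_comp => //.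
apply: measurable_funB; apply: measurable_funM => //; apply: measurable_funX => //.
by apply: measurable_funM => //; exact: measurable_funB.
Qed.

Lemma gdens_pdf c s y : 0 < c ->
  gdens c s y * normal_pdf 0 1 y = c^-1 * normal_pdf 0 1 ((y - s) / c).
Proof.
move=> c0; rewrite normal_pdfE ?oner_eq0// /gdens /normal_fun.
rewrite !subr0 !expr1n -[LHS]mulrA [X in _ * X = _]mulrCA -expRD; congr (_ * (_ * expR _)).
by field; rewrite gt_eqF.
Qed.

Context {dT : measure_display} {T : measurableType dT} (P : probability T R).

Lemma ge0_integral_std_normal (U : T -> R) (h : R -> \bar R) : std_normal P U ->
  measurable_fun setT h -> (forall x, 0 <= h x)%E ->
  (\int[P]_w h (U w) = \int[mu]_x (h x * (normal_pdf 0 1 x)%:E))%E.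
Proof.
move=> [mU PU] mh h0; rewrite -ge0_integral_normal//.
have := ge0_integral_pushforward
  (mU : measurable_fun setT (U : T -> measurableTypeR R)) P measurableT mh (fun x _ => h0
    x).
rewrite preimage_setT /= => <-.
by apply: eq_measure_integral => A mA _; exact: PU.
Qed.

Lemma std_normal_affine (U : T -> R) (h : R -> \bar R) c s : 0 < c ->
  std_normal P U -> measurable_fun setT h -> (forall x, 0 <= h x)%E ->
  (\int[P]_w h (c * U w + s)%R = \int[P]_w (h (U w) * (gdens c s (U w))%:E))%E.
Proof.
move=> c0 nU mh h0.
have maff : measurable_fun setT (fun x : R => c * x + s).
  by apply: measurable_funD => //; exact: measurable_funM.
rewrite (ge0_integral_std_normal (h := fun x => h (c * x + s)%R) nU)//; last first.
  exact: measurableT_comp mh maff.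
rewrite (ge0_integral_std_normal (h := fun x => h x * (gdens c s x)%:E)%E nU); last 2 first.
- apply: emeasurable_funM => //; apply/measurable_EFinP; exact: measurable_gdens.
- by move=> x; rewrite mule_ge0 ?lee_fin ?gdens_ge0.
under [RHS]eq_integral => x _.
  rewrite -muleA -EFinM gdens_pdf// EFinM muleCA; over.
rewrite ge0_integralZl//=; last 3 first.
- apply: emeasurable_funM => //; apply/measurable_EFinP.
  apply: (measurableT_comp (measurable_normal_pdf 0 1)).
  by apply: measurable_funM => //; exact: measurable_funB.
- by move=> x _; rewrite mule_ge0// lee_fin normal_pdf_ge0.
- by rewrite lee_fin invr_ge0 ltW.
rewrite [in RHS](@ge0_integral_affine c s)//; last 2 first.
- apply: emeasurable_funM => //; apply/measurable_EFinP.
  apply: (measurableT_comp (measurable_normal_pdf 0 1)).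
  by apply: measurable_funM => //; exact: measurable_funB.
- by move=> x; rewrite mule_ge0// lee_fin normal_pdf_ge0.
rewrite muleA -EFinM mulVf ?gt_eqF// mul1e; apply: eq_integral => x _.
by rewrite addrK mulrAC mulfV ?gt_eqF// mul1r.
Qed.

End gauss1.

(** * Affine changes of variables for Gaussian vectors *)

Section gauss_vector.
Context {R : realType} {d : nat} {dT : measure_display} {T : measurableType dT}.
Context (P : probability T R) (u : 'I_d -> T -> R).
Hypothesis nu : forall i, std_normal P (u i).
Hypothesis iu : mutually_independent P u.

Let mu i : measurable_fun setT (u i). Proof. by case: (nu i). Qed.

(** Coordinate i is separated from the others by independence, the one-dimensional identity is
    applied with the others frozen, and the two integrals are merged again. *)
Lemma gauss_coord_affine (g : 'rV[R]_d -> R) i c s : 0 < c -> vmeas g ->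
  (forall x, 0 <= g x) ->
  (\int[P]_w (g (\row_j (if j == i then c * u j w + s else u j w)))%:E =
   \int[P]_w (g (\row_j u j w) * gdens c s (u i w))%:E)%E.
Proof.
move=> c0 mg g0.
pose J1 := [seq j <- enum 'I_d | j != i]; pose J2 := [:: i].
have J12 : ~~ has (mem J1) J2 by rewrite /= mem_filter eqxx.
pose T1 := g_sigma_algebraType (cylinders u J1).
pose T2 := g_sigma_algebraType (cylinders u J2).
have m1 j : j != i -> measurable_fun setT (fun z : T1 * T2 => u j z.1).
  move=> ji; apply: (measurableT_comp _ (@measurable_fst _ _ T1 T2)).
  by apply: measurable_cylinders_coord; rewrite mem_filter ji mem_enum.
have m2 : measurable_fun setT (fun z : T1 * T2 => u i z.2).
  apply: (measurableT_comp _ (@measurable_snd _ _ T1 T2)).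
  by apply: measurable_cylinders_coord; rewrite inE.
transitivity (\int[P]_w \int[P]_w'
    (g (\row_j if j == i then c * u i w' + s else u j w))%:E)%E.
  rewrite -(indep_integral mu iu J12
    (g := fun w w' => (g (\row_j if j == i then c * u i w' + s else u j w))%:E)).
  - apply: eq_integral => w _; congr (g _)%:E; apply/rowP => j; rewrite !mxE.
    by case: eqP => // ->.
  - by move=> w w'; rewrite lee_fin.
  - apply/measurable_EFinP;
      apply: (mg _ (T1 * T2)%type (fun j z => if j == i then c * u i z.2 + s else u j
        z.1)) => j.
    case: (eqVneq j i) => [_|ji]; last exact: m1.
    by apply: measurable_funD => //; exact: measurable_funM.
transitivity (\int[P]_w \int[P]_w'
    (g (\row_j if j == i then u i w' else u j w) * gdens c s (u i w'))%:E)%E.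
  apply: eq_integral => w _.
  rewrite (std_normal_affine (h := fun y => (g (\row_j if j == i then y else u j w))%:E)
    s c0 (nu i)).
  - by apply: eq_integral => w' _; rewrite EFinM.
  - apply/measurable_EFinP; apply: (mg _ R (fun j y => if j == i then y else u j w)) => j.
    by case: (j == i); [exact: measurable_id|exact: measurable_cst].
  - by move=> y; rewrite lee_fin.
rewrite -(indep_integral mu iu J12
  (g := fun w w' => (g (\row_j if j == i then u i w' else u j w) * gdens c s (u i w'))%:E)).
- apply: eq_integral => w _; congr (g _ * _)%:E; apply/rowP => j; rewrite !mxE.
  by case: eqP => // ->.
- by move=> w w'; rewrite lee_fin mulr_ge0// gdens_ge0.
- apply/measurable_EFinP; apply: measurable_funM; last first.
    exact: (measurableT_comp (measurable_gdens c s)).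
  apply: (mg _ (T1 * T2)%type (fun j z => if j == i then u i z.2 else u j z.1)) => j.
  by case: (eqVneq j i) => [_|ji]; [exact: m2|exact: m1].
Qed.

(** One coordinate at a time: [g1] contains the affine maps still to be removed, [g2] absorbs the
    density just produced. As i is not in J, these maps leave that density unchanged. *)
Lemma gauss_seq_affine (g : 'rV[R]_d -> R) (J : seq 'I_d) c (s : 'rV[R]_d) :
  0 < c -> uniq J -> vmeas g -> (forall x, 0 <= g x) ->
  (\int[P]_w (g (\row_j if j \in J then c * u j w + s 0 j else u j w))%:E =
   \int[P]_w (g (\row_j u j w) * \prod_(j <- J) gdens c (s 0 j) (u j w))%:E)%E.
Proof.
move=> c0; elim: J g => [|i J ih] g /=.
  by move=> _ mg g0; apply: eq_integral => w _; rewrite big_nil mulr1.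
move=> /andP[iJ uJ] mg g0.
pose g1 (a : 'rV[R]_d) := g (\row_j if j \in J then c * a 0 j + s 0 j else a 0 j).
have mg1 : vmeas g1.
  apply: (vmeas_comp mg) => j.
  rewrite (_ : (fun a => _) = fun a : 'rV[R]_d =>
      if j \in J then c * a 0 j + s 0 j else a 0 j); last first.
    by apply/funext => a; rewrite mxE.
  case: (j \in J); last exact: vmeas_coord.
  by apply: vmeasD (vmeas_cst _); apply: vmeasM (vmeas_cst _) (vmeas_coord _).
pose g2 (a : 'rV[R]_d) := g a * gdens c (s 0 i) (a 0 i).
have mg2 : vmeas g2.
  by apply: vmeasM => //; exact: vmeas_fun (measurable_gdens _ _) (vmeas_coord i).
transitivity (\int[P]_w (g1 (\row_j if j == i then c * u j w + s 0 i else u j w))%:E)%E.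
  apply: eq_integral => w _; congr (g _)%:E; apply/rowP => j; rewrite !mxE inE.
  by have [->|//] := eqVneq j i; rewrite (negbTE iJ).
rewrite gauss_coord_affine//; last by move=> x; exact: g0.
transitivity (\int[P]_w (g2 (\row_j if j \in J then c * u j w + s 0 j else u j w))%:E)%E.
  apply: eq_integral => w _; rewrite /g1 /g2 mxE (negbTE iJ); congr (g _ * _)%:E.
  by apply/rowP => j; rewrite !mxE.
rewrite ih//; last by move=> x; rewrite mulr_ge0// gdens_ge0.
by apply: eq_integral => w _; rewrite big_cons /g2 mxE mulrA.
Qed.

Local Notation ur w := (\row_i u i w).

Lemma gauss_affine (g : 'rV[R]_d -> R) c (s : 'rV[R]_d) :
  0 < c -> vmeas g -> (forall x, 0 <= g x) ->
  (\int[P]_w (g (c *: ur w + s))%:E =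
   \int[P]_w (g (ur w) * (c^-1 ^+ d *
     expR (enorm (ur w) ^+ 2 / 2 - enorm (c^-1 *: (ur w - s)) ^+ 2 / 2)))%:E)%E.
Proof.
move=> c0 mg g0; have := gauss_seq_affine s c0 (enum_uniq 'I_d) mg g0.
under eq_integral => w _ do under eq_mx do rewrite mem_enum/=.
move=> h; transitivity (\int[P]_w (g (\row_j (c * u j w + s 0 j)))%:E)%E.
  by apply: eq_integral => w _; congr (g _)%:E; apply/rowP => j; rewrite !mxE.
rewrite h; apply: eq_integral => w _; congr (_ * _)%:E.
rewrite big_enum/= big_split/= prodr_const card_ord; congr (_ * _).
rewrite -expR_sum; congr expR; rewrite sumrB !enorm_sqr /dotp !mulr_suml.
by congr (_ - _); apply: eq_bigr => i _; rewrite !mxE -?expr2// (mulrC c^-1).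
Qed.

(** The Cameron-Martin formula. *)
Lemma gauss_shift (g : 'rV[R]_d -> R) (s : 'rV[R]_d) :
  vmeas g -> (forall x, 0 <= g x) ->
  (\int[P]_w (g (ur w + s))%:E =
   \int[P]_w (g (ur w) * expR (dotp (ur w) s - enorm s ^+ 2 / 2))%:E)%E.
Proof.
move=> mg g0; have := gauss_affine s ltr01 mg g0.
under eq_integral do rewrite scale1r.
move=> ->; apply: eq_integral => w _.
rewrite invr1 expr1n mul1r scale1r; congr (_ * expR _)%:E.
by rewrite !enorm_sqr !dotpBl !(dotpC _ (_ - s)) !dotpBl (dotpC s); lra.
Qed.

Lemma gauss_scale (g : 'rV[R]_d -> R) c : 0 < c ->
  vmeas g -> (forall x, 0 <= g x) ->
  (\int[P]_w (g (c *: ur w))%:E =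
   \int[P]_w (g (ur w) * (c^-1 ^+ d *
      expR ((1 - c^-1 ^+ 2) / 2 * enorm (ur w) ^+ 2)))%:E)%E.
Proof.
move=> c0 mg g0; have := gauss_affine 0 c0 mg g0.
under eq_integral do rewrite addr0.
move=> ->; apply: eq_integral => w _; congr (_ * (_ * expR _))%:E.
by rewrite subr0 enormZ exprMn real_normK ?num_real//; lra.
Qed.

End gauss_vector.

Section same_law.
Context {R : realType} {d : nat} {dT : measure_display} {T : measurableType dT}.
Context (P : probability T R) (u v : 'I_d -> T -> R).
Hypothesis nu : forall i, std_normal P (u i).
Hypothesis iu : mutually_independent P u.
Hypothesis nv : forall i, std_normal P (v i).
Hypothesis iv : mutually_independent P v.

(** Needed because f_sigma is computed from the first noise vector while step k averages over the
    k-th. The two image measures agree on the coordinate cylinders, a pi-system. *)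
Lemma gauss_same_law (g : 'rV[R]_d -> R) : vmeas g -> (forall x, 0 <= g x) ->
  (\int[P]_w (g (\row_i u i w))%:E = \int[P]_w (g (\row_i v i w))%:E)%E.
Proof.
move=> mg g0.
pose X (i : 'I_d) (a : 'rV[R]_d) : R := a 0 i.
pose G := cylinders X (enum 'I_d); pose V := g_sigma_algebraType G.
have preE (z : 'I_d -> T -> R) (A : 'I_d -> set R) :
    (fun w => \row_i z i w) @^-1` [set a | forall j, j \in enum 'I_d -> A j (X j a)] =
    [set w | forall j, j \in enum 'I_d -> A j (z j w)].
  by apply/seteqP; split => w /= h j jd; have := h j jd; rewrite /X mxE.
have mrow (z : 'I_d -> T -> R) : (forall i, std_normal P (z i)) ->
    measurable_fun setT ((fun w => \row_i z i w) : T -> V).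
  move=> nz; apply: (@measurability _ _ T V setT _ G) => // _ [_ [A mA ->] <-].
  rewrite setTI preE.
  by apply: measurable_cylinder => // j _; case: (nz j).
have mgV : measurable_fun setT (EFin \o g : V -> \bar R).
  apply/measurable_EFinP.
  rewrite (_ : g = fun a => g (\row_i X i a)); last first.
    by apply/funext => a; congr g; apply/rowP => i; rewrite mxE.
  by apply: (mg _ V X) => i; apply: measurable_cylinders_coord; rewrite mem_enum.
have g0' (a : V) : [set: V] a -> (0 <= (EFin \o g) a)%E by rewrite lee_fin.
have := ge0_integral_pushforward (mrow _ nu) P measurableT mgV (fun x _ => g0' x I).
rewrite preimage_setT /= => <-.
have := ge0_integral_pushforward (mrow _ nv) P measurableT mgV (fun x _ => g0' x I).
rewrite preimage_setT /= => <-.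
apply: eq_measure_integral; [exact: (mrow _ nv)|exact: (mrow _ nu)|move=> mu mv A mA _].
have cov : \bigcup_(k : nat) [set: V] = setT by rewrite bigcup_const//; exists 0%N.
apply: (@measure_unique _ _ V G (fun=> setT)) => //.
- exact: cylinders_setI.
- by move=> _; exact: cylinders_setT.
- move=> _ [B mB ->]; rewrite /pushforward/= /pushforward !preE iu ?enum_uniq// iv
    ?enum_uniq//; apply: eq_bigr => i _.
  by rewrite (nu i).2// (nv i).2.
- by move=> _; rewrite /= /pushforward preimage_setT probability_setT ltry.
Qed.

End same_law.

(** * Moments of the standard Gaussian *)

Section expectation_toolkit.
Context {R : realType} {dT : measure_display} {T : measurableType dT}.
Context (P : probability T R).
Implicit Types X Y : T -> R.

Definition intg X := P.-integrable setT (EFin \o X).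

Lemma intg_meas X : intg X -> measurable_fun setT X.
Proof. by move=> /measurable_int/measurable_EFinP. Qed.

Lemma intg_dom X Y : measurable_fun setT X -> (forall w, `|X w| <= Y w) ->
  intg Y -> intg X.
Proof.
move=> mX XY; apply: le_integrable => //; first exact/measurable_EFinP.
by move=> w _ /=; rewrite lee_fin (le_trans (XY w))// ler_norm.
Qed.

Lemma intg_cst (c : R) : intg (fun=> c).
Proof.
by apply: (@finite_measure_integrable_cst _ _ _ P setT c).
Qed.

Lemma intgD X Y : intg X -> intg Y -> intg (fun w => X w + Y w).
Proof. by move=> iX iY; exact: (integrableD measurableT iX iY). Qed.

Lemma intgB X Y : intg X -> intg Y -> intg (fun w => X w - Y w).
Proof. by move=> iX iY; exact: (integrableB measurableT iX iY). Qed.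

Lemma intgZ k X : intg X -> intg (fun w => k * X w).
Proof. by move=> iX; exact: (integrableZl measurableT k iX). Qed.

Lemma intgE X : intg X -> (\int[P]_w (X w)%:E = (\int[P]_w X w)%:E)%E.
Proof. by move=> iX; rewrite fineK// integrable_fin_num. Qed.

Lemma intg_ge0 X : measurable_fun setT X -> (forall w, 0 <= X w) ->
  (\int[P]_w (X w)%:E < +oo)%E -> intg X.
Proof.
move=> mX X0 h; apply/integrableP; split; first exact/measurable_EFinP.
by under eq_integral do rewrite /= ger0_norm//.
Qed.

Lemma RintD X Y : intg X -> intg Y ->
  \int[P]_w (X w + Y w) = \int[P]_w X w + \int[P]_w Y w.
Proof. by move=> iX iY; rewrite RintegralD. Qed.

Lemma RintB X Y : intg X -> intg Y ->
  \int[P]_w (X w - Y w) = \int[P]_w X w - \int[P]_w Y w.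
Proof. by move=> iX iY; rewrite RintegralB. Qed.

Lemma RintZ k X : intg X -> \int[P]_w (k * X w) = k * \int[P]_w X w.
Proof. by move=> iX; rewrite RintegralZl. Qed.

Lemma Rint_cst (c : R) : \int[P]_w c = c.
Proof.
by rewrite /Rintegral integral_cst//= probability_setT mule1.
Qed.

Lemma Rint_le X Y : intg X -> intg Y -> (forall w, X w <= Y w) ->
  \int[P]_w X w <= \int[P]_w Y w.
Proof. by move=> iX iY XY; apply: le_Rintegral. Qed.

Lemma Rint_norm_le X Y : intg X -> intg Y -> (forall w, `|X w| <= Y w) ->
  `|\int[P]_w X w| <= \int[P]_w Y w.
Proof.
move=> iX iY XY; apply: le_trans (le_normr_Rintegral _ iX) _ => //.
by apply: Rint_le => //; exact: integrable_norm.
Qed.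

End expectation_toolkit.

Lemma le_of_le_expr {R : realType} (a b : R) k :
  (forall c, 1 < c -> a <= b * c ^+ k) -> a <= b.
Proof.
move=> h.
have : b * c ^+ k @[c --> (1:R)^'+] --> b * 1 ^+ k.
  apply: cvgM; first exact: cvg_cst.
  by apply: cvg_at_right_filter; exact: exprn_continuous.
rewrite expr1n mulr1 => cv; apply: (cvgr_to_ge cv).
by near=> c; apply: h; near: c; exact: nbhs_right_gt.
Unshelve. all: by end_near. Qed.

(** A first-order upper bound for c^n - 1; its excess factor c^n disappears as c decreases to 1. *)
Lemma expr_sub1_le {R : realType} (c : R) n : 1 <= c ->
  c ^+ n - 1 <= n%:R * (c - 1) * c ^+ n.
Proof.
move=> c1; elim: n => [|n ih]; first by rewrite expr0 subrr mul0r mul0r.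
have cn : 1 <= c ^+ n by rewrite exprn_ege1.
have n0 : 0 <= n%:R :> R by [].
rewrite exprSr -natr1.
have : c ^+ n * c - 1 = (c ^+ n - 1) + c ^+ n * (c - 1) by ring.
move=> ->; move: ih; set e := c ^+ n in cn * => ih.
have : n%:R * (c - 1) * e <= n%:R * (c - 1) * (e * c).
  by rewrite ler_wpM2l ?mulr_ge0 ?subr_ge0// ler_peMr//; lra.
have : e * (c - 1) <= e * c * (c - 1).
  by rewrite ler_wpM2r ?subr_ge0// ler_peMr//; lra.
by move=> h1 h2; rewrite (mulrDl n%:R) mulrDl; lra.
Qed.

Section moments.
Context {R : realType} {d : nat} {dT : measure_display} {T : measurableType dT}.
Context (P : probability T R) (u : 'I_d -> T -> R).
Hypothesis nu : forall i, std_normal P (u i).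
Hypothesis iu : mutually_independent P u.
Local Notation ur w := (\row_i u i w).

Lemma measurable_gauss g : vmeas g -> measurable_fun setT (fun w => g (ur w)).
Proof. by move=> mg; apply: mg => i; case: (nu i). Qed.

Lemma vmeas_enorm : vmeas (@enorm R d).
Proof. exact: econt_vmeas econt_enorm. Qed.

(* Comparing the moment of c u with its change-of-variables expression and
   letting c decrease to 1. *)
Lemma moment_step p : intg P (fun w => enorm (ur w) ^+ (2 * p)) ->
  intg P (fun w => enorm (ur w) ^+ (2 * p.+1)) /\
  \int[P]_w (enorm (ur w) ^+ (2 * p.+1)) <=
    (2 * p + d)%:R * \int[P]_w (enorm (ur w) ^+ (2 * p)).
Proof.
move=> ip; set x := \int[P]_w (_ ^+ (2 * p)); set n := (2 * p + d)%N.
have x0 : 0 <= x by apply: Rintegral_ge0 => w _; rewrite exprn_ge0 ?enorm_ge0.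
have me q : vmeas (fun a => @enorm R d a ^+ q) by exact: vmeasX vmeas_enorm.
have e0 q (a : 'rV[R]_d) : 0 <= enorm a ^+ q by rewrite exprn_ge0 ?enorm_ge0.
pose a c : R := (1 - c^-1 ^+ 2) / 2.
have a0 c : 1 < c -> 0 < a c.
  move=> c1; rewrite divr_gt0// subr_gt0 -[ltRHS](expr1n _ 2).
  by rewrite ltrXn2r// ?nnegrE ?invr_ge0 ?invf_lt1//; lra.
(* Kept extended-real: finiteness of this moment is part of the claim. *)
pose y := (\int[P]_w (enorm (ur w) ^+ (2 * p.+1))%:E)%E.
have y0 : (0 <= y)%E by apply: integral_ge0 => w _; rewrite lee_fin.
(* By scaling, c^(2p) x = E[|u|^(2p) c^(-d) exp(a(c) |u|^2)], which is at least c^(-d) (x + a(c)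
   y). *)
have key c : 1 < c -> ((a c)%:E * y <= ((c ^+ n - 1) * x)%:E)%E.
  move=> c1; have c0 : 0 < c by lra.
  have := gauss_scale nu iu c0 (me (2 * p)%N) (e0 _).
  under eq_integral do rewrite enormZ gtr0_norm// exprMn EFinM.
  rewrite ge0_integralZl//; last 3 first.
  - by apply/measurable_EFinP; exact: (measurable_gauss (me _)).
  - by move=> w _; rewrite lee_fin.
  - by rewrite lee_fin exprn_ge0// ltW.
  rewrite (intgE ip) -/x => sc.
  have : ((c^-1 ^+ d)%:E * (x%:E + (a c)%:E * y) <= (c ^+ (2 * p))%:E * x%:E)%E.
    rewrite sc /x /y -(intgE ip) -ge0_integralZl//; last 3 first.
    - by apply/measurable_EFinP; exact: (measurable_gauss (me _)).
    - by move=> w _; rewrite lee_fin.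
    - by rewrite lee_fin ltW// a0.
    rewrite -ge0_integralD//; last 4 first.
    - by move=> w _; rewrite lee_fin.
    - by apply/measurable_EFinP; exact: (measurable_gauss (me _)).
    - by move=> w _; rewrite lee_fin mulr_ge0// ltW// a0.
    - by apply/measurable_EFinP; apply: measurable_funM => //;
        exact: (measurable_gauss (me _)).
    rewrite -ge0_integralZl//; last 3 first.
    - apply/measurable_EFinP; apply: measurable_funD;
        first exact: (measurable_gauss (me _)).
      by apply: measurable_funM => //; exact: (measurable_gauss (me _)).
    - by move=> w _; rewrite lee_fin addr_ge0// mulr_ge0// ltW// a0.
    - by rewrite lee_fin exprn_ge0// invr_ge0 ltW.
    apply: ge0_le_integral => //.
    - by move=> w _; rewrite lee_fin mulr_ge0 ?exprn_ge0 ?invr_ge0 ?(ltW c0)// addr_ge0//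
        mulr_ge0// ltW// a0.
    - apply/measurable_EFinP; apply: measurable_funM => //; apply: measurable_funD;
        first exact: (measurable_gauss (me _)).
      by apply: measurable_funM => //; exact: (measurable_gauss (me _)).
    - apply/measurable_EFinP; apply: (measurable_gauss (g := fun z => enorm z ^+ (2 * p) *
        (c^-1 ^+ d * expR ((1 - c^-1 ^+ 2) / 2 * enorm z ^+ 2)))).
      apply: vmeasM => //; apply: vmeasM; first exact: vmeas_cst.
      apply: vmeas_fun; first exact: measurable_expR.
      by apply: vmeasM => //; exact: vmeas_cst.
    - move=> w _; rewrite lee_fin mulrCA ler_wpM2l ?exprn_ge0 ?invr_ge0 ?(ltW c0)//.
      rewrite mulnS addnC exprD mulrCA -{1}[X in X + _]mulr1 -mulrDr ler_wpM2l//.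
      exact: expR_ge1Dx.
  move: y0; case: y => [r| |]//= y0; last first.
    rewrite gt0_muley ?lte_fin ?a0// addey// gt0_muley ?lte_fin ?exprn_gt0 ?invr_gt0//.
  rewrite -(EFinM (a c) r) -(EFinD x (a c * r)) -!EFinM !lee_fin exprVn ler_pdivrMl
    ?exprn_gt0//.
  by rewrite mulrA -exprD addnC -/n mulrBl mul1r; lra.
(* A single value c > 1 suffices: an infinite y would make the left side of [key] infinite. *)
have yfin : (y < +oo)%E.
  have := key 2 ltac:(lra); move: y0 {key}; case: y => [r| |]//= y0; first by rewrite ltry.
  by rewrite gt0_muley ?lte_fin ?a0//; lra.
have iS : intg P (fun w => enorm (ur w) ^+ (2 * p.+1)).
  by apply: intg_ge0 => //; exact: (measurable_gauss (me _)).
split => //.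
have yE : y = (\int[P]_w (enorm (ur w) ^+ (2 * p.+1)))%:E by exact: intgE.
move: key; rewrite yE; set z := \int[P]_w _ => key.
have z0 : 0 <= z by rewrite -lee_fin -yE.
(* The exponent collects c^n from [expr_sub1_le] and c^2 from a(c) = (c - 1)(c + 1) / (2 c^2); the
   factor c - 1 then cancels and c + 1 >= 2. *)
apply: (@le_of_le_expr _ _ _ n.+2) => c c1.
have := key c c1; rewrite -EFinM lee_fin => h1.
have h2 := expr_sub1_le n (ltW c1).
have c0 : 0 < c by lra.
have h3 : a c * z <= n%:R * (c - 1) * c ^+ n * x.
  by apply: le_trans h1 _; rewrite ler_wpM2r.
have aE : a c * (2 * c ^+ 2) = (c - 1) * (c + 1).
  by rewrite /a; field; rewrite gt_eqF.
have h4 : (c - 1) * ((c + 1) * z) <= (c - 1) * (n%:R * x * c ^+ n.+2 * 2).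
  rewrite mulrA -aE.
  have : a c * (2 * c ^+ 2) * z = 2 * c ^+ 2 * (a c * z) by ring.
  move=> ->; have c20 : 0 <= 2 * c ^+ 2 by rewrite mulr_ge0// exprn_ge0// ltW.
  apply: le_trans (ler_wpM2l c20 h3) _.
  by rewrite le_eqVlt; apply/orP; left; apply/eqP; rewrite !exprS; ring.
move: h4; rewrite ler_pM2l ?subr_gt0// => h4.
have : (c + 1) * z >= 2 * z by rewrite ler_wpM2r//; lra.
lra.
Qed.

Lemma moment_even_prod p : intg P (fun w => enorm (ur w) ^+ (2 * p)) /\
  \int[P]_w (enorm (ur w) ^+ (2 * p)) <= \prod_(j < p) (2 * j + d)%:R.
Proof.
elim: p => [|p [ip hp]].
  have -> : (fun w => enorm (ur w) ^+ (2 * 0)) = (fun=> 1 : R).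
    by apply/funext => w; rewrite muln0 expr0.
  by split; [exact: intg_cst|rewrite Rint_cst big_ord0].
have [iS hS] := moment_step ip; split => //.
by apply: le_trans hS _; rewrite big_ord_recr/= mulrC ler_wpM2r.
Qed.

Lemma prod_moment_le p : \prod_(j < p) (2 * j + d)%:R <= (2 * p + d)%:R ^+ p :> R.
Proof.
rewrite -[X in _ ^+ X](card_ord p) -prodr_const.
apply: ler_prod => j _; rewrite ler0n ler_nat/= leq_add2r leq_mul2l.
by rewrite (ltnW (ltn_ord j)) orbT.
Qed.

Lemma moment_even p :
  \int[P]_w (enorm (ur w) ^+ (2 * p)) <= (2 * p + d)%:R ^+ p.
Proof. exact: le_trans (moment_even_prod p).2 (prod_moment_le p). Qed.

Lemma moment_intg q : intg P (fun w => enorm (ur w) ^+ q).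
Proof.
apply: (@intg_dom _ _ _ _ _ (fun w => 1 + enorm (ur w) ^+ (2 * q))).
- by apply: (measurable_gauss (g := fun a => enorm a ^+ q)); exact: vmeasX vmeas_enorm.
- move=> w; rewrite ger0_norm ?exprn_ge0 ?enorm_ge0// mulnC exprM.
  by set e := _ ^+ q; nra.
- by apply: intgD; [exact: intg_cst|exact: (moment_even_prod q).1].
Qed.

(* AM-GM between the two neighbouring even moments. *)
Lemma moment_odd p : \int[P]_w (enorm (ur w) ^+ (2 * p).+1) <=
  Num.sqrt (2 * p + d)%:R * \prod_(j < p) (2 * j + d)%:R.
Proof.
(* In dimension 0 the weight s below may vanish and could not be divided by. *)
have [d0|d0] := eqVneq d 0%N.
  have -> : (fun w => enorm (ur w) ^+ (2 * p).+1) = (fun=> 0).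
    apply/funext => w; rewrite exprS (_ : enorm _ = 0) ?mul0r//.
    apply/eqP; rewrite -sqrf_eq0 enorm_sqr /dotp big1// => i.
    by exfalso; move: (ltn_ord i); rewrite {2}d0.
  by rewrite Rint_cst mulr_ge0 ?sqrtr_ge0// prodr_ge0.
set s := Num.sqrt _.
have n0 : 0 < (2 * p + d)%:R :> R by rewrite ltr0n addn_gt0 (lt0n d) d0 orbT.
have s0 : 0 < s by rewrite sqrtr_gt0.
have s2 : s ^+ 2 = (2 * p + d)%:R by rewrite sqr_sqrtr// ltW.
have i1 := moment_intg (2 * p); have i2 := moment_intg (2 * p.+1).
have h1 := (moment_even_prod p).2; have h2 := (moment_step i1).2.
set x := \int[P]_w (_ ^+ (2 * p)) in h1 h2.
set y := \int[P]_w (_ ^+ (2 * p.+1)) in h2.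
(* From e <= s/2 + e^2/(2s). As y <= s^2 x, the choice s^2 = 2p + d balances the two halves. *)
have h : \int[P]_w (enorm (ur w) ^+ (2 * p).+1) <= s / 2 * x + (2 * s)^-1 * y.
  rewrite /x /y -!RintZ// -RintD; [|exact: intgZ|exact: intgZ].
  apply: Rint_le; [exact: moment_intg|by apply: intgD; exact: intgZ|].
  move=> w; set e := enorm _; rewrite mulnS addnC exprD exprS.
  have e0 : 0 <= e ^+ (2 * p) by rewrite exprn_ge0 ?enorm_ge0.
  have -> : s / 2 * e ^+ (2 * p) + (2 * s)^-1 * (e ^+ (2 * p) * e ^+ 2) =
    e * e ^+ (2 * p) + e ^+ (2 * p) * ((s - e) ^+ 2 * (2 * s)^-1).
    by field; rewrite gt_eqF.
  by rewrite lerDl mulr_ge0// mulr_ge0 ?sqr_ge0// invr_ge0 mulr_ge0// ltW.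
apply: le_trans h _.
have : (2 * s)^-1 * y <= (2 * s)^-1 * (s ^+ 2 * x).
  by rewrite ler_wpM2l ?invr_ge0 ?mulr_ge0 ?(ltW s0)// s2.
have -> : (2 * s)^-1 * (s ^+ 2 * x) = s / 2 * x by field; rewrite gt_eqF.
move=> h3; apply: (@le_trans _ _ (s * x)); first by lra.
by rewrite ler_wpM2l// ltW.
Qed.

Lemma moment1 : \int[P]_w enorm (ur w) <= Num.sqrt d%:R.
Proof. by have := moment_odd 0; rewrite muln0 add0n big_ord0 mulr1. Qed.

Lemma moment q : \int[P]_w (enorm (ur w) ^+ q) <= (q + d)%:R `^ (q%:R / 2).
Proof.
have halfE p : (2 * p)%:R / 2 = p%:R :> R by rewrite natrM mulrAC mulfV ?mul1r.
have [q2|q2] := boolP (odd q).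
  have -> : q = (2 * q./2).+1 by rewrite mul2n -{1}(odd_double_half q) q2.
  set p := q./2; apply: le_trans (moment_odd p) _.
  have b0 : 0 <= (2 * p + d)%:R :> R by [].
  apply: (@le_trans _ _ ((2 * p + d)%:R `^ ((2 * p).+1%:R / 2))); last first.
    by rewrite ge0_ler_powR ?divr_ge0 ?nnegrE// ler_nat leq_add2r.
  have [z|z] := eqVneq ((2 * p + d)%:R : R) 0.
    by rewrite z sqrtr0 mul0r powR_ge0.
  rewrite -natr1 mulrDl halfE div1r powRD; last by rewrite z implybT.
  rewrite powR12_sqrt// powR_mulrn// mulrC ler_wpM2r ?sqrtr_ge0//.
  exact: prod_moment_le.
have -> : q = (2 * q./2)%N.
  by rewrite mul2n -{1}(odd_double_half q) (negbTE q2).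
set p := q./2; apply: le_trans (moment_even p) _.
by rewrite halfE powR_mulrn.
Qed.

End moments.

(** * Gaussian smoothing *)

Lemma is_derive_quadratic {R : realType} {V : normedModType R} (g : V -> R)
    (y h : V) (L K : R) :
  (forall s, `|s| <= 1 -> `|g (y + s *: h) - g y - s * L| <= K * s ^+ 2) ->
  is_derive y h g L.
Proof.
move=> hK.
have cv : (fun s => s^-1 *: ((g \o shift y) (s *: h) - g y)) @ 0^' --> L.
  apply/cvgrPdist_le => e e0.
  have K1 : 0 < 1 + `|K| by rewrite ltr_pwDl.
  near=> s.
  have s0 : s != 0 by near: s; exact: nbhs_dnbhs_neq.
  have s1 : `|s| <= 1.
    near: s; apply: dnbhs0_le; exact: ltr01.
  have se : `|s| <= e / (1 + `|K|).
    by near: s; apply: dnbhs0_le; rewrite divr_gt0.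
  rewrite /= [s *: h + y]addrC distrC.
  have -> : s^-1 *: (g (y + s *: h) - g y) - L =
      s^-1 * (g (y + s *: h) - g y - s * L) by rewrite /GRing.scale/=; field.
  rewrite normrM normfV ler_pdivrMl ?normr_gt0//.
  apply: le_trans (hK s s1) _; rewrite -real_normK ?num_real// expr2.
  move: se; rewrite ler_pdivlMr// => se; have := normr_ge0 s.
  by have := ler_norm K; nra.
by split; [apply/cvg_ex; exists L|exact: cvg_lim cv].
Unshelve. all: by end_near. Qed.

Lemma econt_lipschitz {R : realType} {d : nat} (g : 'rV[R]_d -> R) :
  (forall x, exists K, forall h, enorm h <= 1 -> `|g (x + h) - g x| <= K * enorm h) ->
  econt g.
Proof.
move=> hg x e e0; have [K hK] := hg x.
have K1 : 0 < 1 + `|K| by rewrite ltr_pwDl.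
exists (Num.min 1 (e / (1 + `|K|))); first by rewrite lt_min ltr01 divr_gt0.
move=> y; rewrite lt_min => /andP[y1 ye].
have := hK (y - x) (ltW y1); rewrite (addrC x) subrK => h; apply: le_lt_trans h _.
move: ye; rewrite ltr_pdivlMr// => ye.
by have := ler_norm K; have := enorm_ge0 (y - x); nra.
Qed.

Lemma vmeas_affine {R : realType} {d : nat} (g : 'rV[R]_d -> R) x (s : R) :
  vmeas g -> vmeas (fun a => g (x + s *: a)).
Proof.
move=> mg; apply: (vmeas_comp (F := fun a => x + s *: a) mg) => i.
rewrite (_ : (fun a => _) = fun a : 'rV[R]_d => x 0 i + s * a 0 i); last first.
  by apply/funext => a; rewrite !mxE.
by apply: vmeasD (vmeas_cst _) _; apply: vmeasM (vmeas_cst _) (vmeas_coord _).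
Qed.

Section smoothing.
Context {R : realType} {d : nat} {dT : measure_display} {T : measurableType dT}.
Context (P : probability T R) (u : 'I_d -> T -> R).
Hypothesis nu : forall i, std_normal P (u i).
Hypothesis iu : mutually_independent P u.
Local Notation ur w := (\row_i u i w).

Lemma shift_lower (g : 'rV[R]_d -> R) s : vmeas g -> (forall x, 0 <= g x) ->
  intg P (fun w => g (ur w + s)) -> intg P (fun w => g (ur w)) ->
  intg P (fun w => g (ur w) * dotp (ur w) s) ->
  \int[P]_w g (ur w) + \int[P]_w (g (ur w) * dotp (ur w) s)
    - enorm s ^+ 2 / 2 * \int[P]_w g (ur w) <= \int[P]_w g (ur w + s).
Proof.
move=> mg g0 is_ ig igd.
have sh := gauss_shift nu iu s mg g0.
have -> : \int[P]_w g (ur w + s) =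
    \int[P]_w (g (ur w) * expR (dotp (ur w) s - enorm s ^+ 2 / 2)).
  by rewrite /Rintegral sh.
rewrite -RintD// -RintZ// -RintB; [|exact: intgD|exact: intgZ].
apply: Rint_le.
- by apply: intgB; [exact: intgD|exact: intgZ].
- apply: intg_ge0.
  + apply: (measurable_gauss nu (g := fun a => g a * expR (dotp a s - enorm s ^+ 2 / 2))).
    apply: vmeasM => //; apply: vmeas_fun; first exact: measurable_expR.
    by apply: vmeasB (vmeas_cst _); apply: econt_vmeas; exact: econt_dotp.
  + by move=> w; rewrite mulr_ge0// expR_ge0.
  (* The exponentially weighted integral is finite because the shift identity equates it with a
     finite one. *)
  + by rewrite -sh (intgE is_) ltry.
move=> w; have := expR_ge1Dx (dotp (ur w) s - enorm s ^+ 2 / 2).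
by have := g0 (ur w); nra.
Qed.

Lemma intg_dotp b : intg P (fun w => dotp (ur w) b).
Proof.
apply: (@intg_dom _ _ _ _ _ (fun w => enorm b * enorm (ur w) ^+ 1)).
- by apply: (measurable_gauss nu (g := fun a => dotp a b));
    exact: econt_vmeas (econt_dotp b).
- by move=> w; rewrite mulrC normr_dotp_le.
- by apply: intgZ; exact: moment_intg.
Qed.

(** [shift_lower] with g = 1 and shift t c gives t E<u, c> <= t^2 |c|^2 / 2; a small t yields E<u,
    c> <= 0, and c = -b the reverse sign. *)
Lemma Rint_dotp b : \int[P]_w dotp (ur w) b = 0.
Proof.
have le0 c : \int[P]_w dotp (ur w) c <= 0.
  apply/ler_addgt0Pr => e e0; rewrite add0r.
  have c1 : 0 < enorm c ^+ 2 + 1 by have := sqr_ge0 (enorm c); lra.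
  pose t := 2 * e / (enorm c ^+ 2 + 1).
  have t0 : 0 < t by rewrite divr_gt0// mulr_gt0.
  have tE : t * (enorm c ^+ 2 + 1) = 2 * e by rewrite mulfVK// gt_eqF.
  have id_ : intg P (fun w => 1 * dotp (ur w) (t *: c)).
    by apply: intgZ; exact: intg_dotp.
  have := shift_lower (g := fun=> 1) (s := t *: c) (vmeas_cst 1) (fun=> ler01)
    (intg_cst P 1) (intg_cst P 1) id_.
  rewrite RintZ; last exact: intg_dotp.
  under [X in _ + 1 * X - _ <= _]eq_Rintegral do rewrite dotpZr.
  rewrite RintZ; last exact: intg_dotp.
  rewrite !Rint_cst mul1r mulr1 enormZ exprMn real_normK ?num_real//.
  set E := \int[P]_w _ => h.
  have : t * E <= t * (t * enorm c ^+ 2 / 2) by lra.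
  rewrite ler_pM2l//; lra.
apply/eqP; rewrite eq_le le0/=; have := le0 (- b).
under eq_Rintegral do rewrite dotpNr -mulN1r.
by rewrite RintZ ?mulN1r ?oppr_le0//; exact: intg_dotp.
Qed.

Variables (m : nat) (f : 'rV[R]_d -> R) (R1 R2 sigma M : R).
Hypothesis fspb : SPB f R1 R2 m.
Hypothesis s0 : 0 < sigma.
Hypothesis fM : forall x, M <= f x.

Local Notation rho := ((2 : R) ^ (m%:Z - 1) * R1).
Local Notation rho2 := ((2 : R) ^ (2 * m%:Z - 2) * R1).

Lemma rho2_ge0 : 0 <= rho2.
Proof. by rewrite mulr_ge0 ?(SPB_R1_ge0 fspb)// exprz_ge0. Qed.

Let rho0 : 0 <= rho := SPB_rho_ge0 fspb.

Lemma rho_exprD (s t : R) : 0 <= s -> 0 <= t ->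
  rho * (s + t) ^+ m <= rho2 * (s ^+ m + t ^+ m).
Proof.
move=> hs ht; rewrite -mulrA.
have -> : rho2 = (2 : R) ^ (m%:Z - 1) * rho.
  by rewrite mulrA -expfzDr//; congr (_ ^ _ * _); ring.
by rewrite -[leRHS]mulrA ler_wpM2l ?exprz_ge0// (SPB_exprD fspb).
Qed.

Lemma econt_SPB : econt f.
Proof.
apply: econt_lipschitz => x; exists (rho * (enorm x ^+ m + 1) + R2) => h h1.
apply: le_trans (SPB_growth fspb x h) _; rewrite ler_wpM2r ?enorm_ge0// lerD2r.
by rewrite ler_wpM2l// lerD2l exprn_ile1 ?enorm_ge0.
Qed.

Lemma vmeas_SPB : vmeas f. Proof. exact: econt_vmeas econt_SPB. Qed.

Lemma measurable_fgauss x : measurable_fun setT (fun w => f (x + sigma *: ur w)).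
Proof. exact: (measurable_gauss nu (vmeas_affine x sigma vmeas_SPB)). Qed.

Lemma df_le x a : `|f (x + sigma *: a) - f x| <=
  sigma * ((rho * enorm x ^+ m + R2) * enorm a + rho * sigma ^+ m * enorm a ^+ m.+1).
Proof.
apply: le_trans (SPB_growth fspb x _) _.
rewrite enormZ gtr0_norm// exprMn exprS le_eqVlt; apply/orP; left; apply/eqP; ring.
Qed.

(** The growth bound is used at base point x + sigma a, whose power is split once more: hence [rho2]
    on |x|^m and |a|^m but only [rho] on |h|^m. *)
Lemma fdiff_le x h a : `|f (x + h + sigma *: a) - f (x + sigma *: a)| <=
  (rho2 * enorm x ^+ m + R2 + rho * enorm h ^+ m
   + rho2 * sigma ^+ m * enorm a ^+ m) * enorm h.
Proof.
rewrite addrAC; apply: le_trans (SPB_growth fspb _ h) _.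
rewrite ler_wpM2r ?enorm_ge0//.
have : rho * enorm (x + sigma *: a) ^+ m <=
    rho2 * (enorm x ^+ m + (sigma * enorm a) ^+ m).
  apply: le_trans (rho_exprD (enorm_ge0 _) _); last by rewrite mulr_ge0 ?enorm_ge0 ?ltW.
  rewrite ler_wpM2l// lerXn2r ?nnegrE ?enorm_ge0 ?addr_ge0 ?mulr_ge0 ?enorm_ge0 ?(ltW s0)//.
  by apply: le_trans (enormD _ _) _; rewrite enormZ gtr0_norm.
by rewrite exprMn; lra.
Qed.

Let mom q := moment_intg nu iu q.

Lemma intg_df x : intg P (fun w => f (x + sigma *: ur w) - f x).
Proof.
apply: (@intg_dom _ _ _ _ _ (fun w => sigma * ((rho * enorm x ^+ m + R2) * enorm (ur w) ^+ 1
   + rho * sigma ^+ m * enorm (ur w) ^+ m.+1))).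
- by apply: measurable_funB => //; exact: measurable_fgauss.
- by move=> w; exact: df_le.
- by apply: intgZ; apply: intgD; apply: intgZ.
Qed.

Lemma intg_f x : intg P (fun w => f (x + sigma *: ur w)).
Proof.
have := intgD (intg_df x) (intg_cst P (f x)).
by under eq_fun do rewrite subrK.
Qed.

Lemma intg_dfd x b : intg P (fun w => (f (x + sigma *: ur w) - f x) * dotp (ur w) b).
Proof.
apply: (@intg_dom _ _ _ _ _ (fun w => enorm b * (sigma * ((rho * enorm x ^+ m + R2) *
  enorm (ur w) ^+ 2
   + rho * sigma ^+ m * enorm (ur w) ^+ m.+2)))).
- apply: measurable_funM; last exact: intg_meas (intg_dotp b).
  by apply: measurable_funB => //; exact: measurable_fgauss.
- move=> w; rewrite normrM.
  apply: le_trans (ler_pM _ _ (df_le x (ur w)) (normr_dotp_le _ _)) _ => //.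
  by rewrite le_eqVlt; apply/orP; left; apply/eqP; rewrite !exprS; ring.
- by do 2 apply: intgZ; apply: intgD; apply: intgZ.
Qed.

Definition fsm x := \int[P]_w f (x + sigma *: ur w).
(** The inner product of b with the mean search direction. Since E<u, b> = 0, subtracting [f x]
    leaves the value of E[f(x + sigma u) <u, b>] / sigma. *)
Definition dfsm x b :=
  sigma^-1 * \int[P]_w ((f (x + sigma *: ur w) - f x) * dotp (ur w) b).
Definition gradsm x := \row_i dfsm x (evec i).

Lemma dfsmD x a b : dfsm x (a + b) = dfsm x a + dfsm x b.
Proof.
rewrite /dfsm -mulrDr -RintD; [|exact: intg_dfd|exact: intg_dfd].
by congr (_ * _); apply: eq_Rintegral => w _; rewrite dotpDr mulrDr.
Qed.

Lemma dfsmZ x k a : dfsm x (k *: a) = k * dfsm x a.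
Proof.
rewrite /dfsm mulrCA -(RintZ k); last exact: intg_dfd.
by congr (_ * _); apply: eq_Rintegral => w _; rewrite dotpZr mulrCA.
Qed.

Lemma dotp_gradsm x b : dotp (gradsm x) b = dfsm x b.
Proof.
rewrite {2}[b]row_evec_sum /dotp.
elim/big_ind2: _ => [|a a' c c' -> ->|i _]; last 2 first.
- by rewrite dfsmD.
- by rewrite dfsmZ mxE mulrC.
by rewrite -(scale0r (0 : 'rV[R]_d)) dfsmZ mul0r.
Qed.

Lemma fsm_ge x : M <= fsm x.
Proof. by rewrite -(Rint_cst P M); apply: Rint_le => //;
  [exact: intg_cst|exact: intg_f]. Qed.

Lemma fsm_lower x h :
  fsm x + dfsm x h - enorm h ^+ 2 / (2 * sigma ^+ 2) * (fsm x - M) <= fsm (x + h).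
Proof.
pose g a := f (x + sigma *: a) - M.
have mg : vmeas g by apply: vmeasB (vmeas_cst _); exact: vmeas_affine vmeas_SPB.
have g0 a : 0 <= g a by rewrite subr_ge0.
have sE a : x + sigma *: (a + sigma^-1 *: h) = x + h + sigma *: a.
  by rewrite scalerDr scalerA mulfV ?gt_eqF// scale1r addrA addrAC.
have gE w : g (ur w + sigma^-1 *: h) = f (x + h + sigma *: ur w) - M.
  by rewrite /g sE.
(* Passing from f - M to the increment of f costs only a multiple of <u, h>, which has mean zero. *)
have dE w : g (ur w) * dotp (ur w) (sigma^-1 *: h) =
    sigma^-1 * ((f (x + sigma *: ur w) - f x) * dotp (ur w) h)
    + (sigma^-1 * (f x - M)) * dotp (ur w) h.
  by rewrite /g dotpZr; ring.
have i1 : intg P (fun w => g (ur w + sigma^-1 *: h)).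
  by under eq_fun do rewrite gE; apply: intgB (intg_cst _ _); exact: intg_f.
have i2 : intg P (fun w => g (ur w)).
  by apply: intgB (intg_cst _ _); exact: intg_f.
have i3 : intg P (fun w => g (ur w) * dotp (ur w) (sigma^-1 *: h)).
  under eq_fun do rewrite dE.
  by apply: intgD; apply: intgZ; [exact: intg_dfd|exact: intg_dotp].
have := shift_lower mg g0 i1 i2 i3.
have -> : \int[P]_w g (ur w) = fsm x - M.
  by rewrite RintB ?Rint_cst//; [exact: intg_f|exact: intg_cst].
have -> : \int[P]_w g (ur w + sigma^-1 *: h) = fsm (x + h) - M.
  under eq_Rintegral do rewrite gE.
  by rewrite RintB ?Rint_cst//; [exact: intg_f|exact: intg_cst].
under eq_Rintegral do rewrite dE.
rewrite RintD; [|by apply: intgZ; exact: intg_dfd|by apply: intgZ; exact: intg_dotp].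
rewrite RintZ; last exact: intg_dfd.
rewrite RintZ; last exact: intg_dotp.
rewrite Rint_dotp mulr0 addr0 -/(dfsm x h) enormZ exprMn.
rewrite real_normK ?num_real//.
have -> : sigma^-1 ^+ 2 * enorm h ^+ 2 / 2 = enorm h ^+ 2 / (2 * sigma ^+ 2).
  by field; rewrite gt_eqF.
lra.
Qed.

Lemma fsm_lip x h : `|fsm (x + h) - fsm x| <=
  (rho2 * enorm x ^+ m + R2 + rho * enorm h ^+ m
   + rho2 * sigma ^+ m * \int[P]_w (enorm (ur w) ^+ m)) * enorm h.
Proof.
rewrite /fsm -RintB; [|exact: intg_f|exact: intg_f].
have i1 : intg P (fun w => rho2 * sigma ^+ m * enorm (ur w) ^+ m) by exact: intgZ.
apply: le_trans (Rint_norm_le (Y := fun w => enorm h * ((rho2 * enorm x ^+ m + R2 + rho *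
  enorm h ^+ m)
   + rho2 * sigma ^+ m * enorm (ur w) ^+ m)) _ _ _) _.
- by apply: intgB; exact: intg_f.
- by apply: intgZ; apply: intgD => //; exact: intg_cst.
- by move=> w; rewrite mulrC; exact: fdiff_le.
rewrite RintZ; last by apply: intgD => //; exact: intg_cst.
rewrite RintD//; last exact: intg_cst.
by rewrite Rint_cst (RintZ _ (mom m)) [leLHS]mulrC.
Qed.

Lemma econt_fsm : econt fsm.
Proof.
apply: econt_lipschitz => x.
exists (rho2 * enorm x ^+ m + R2 + rho
   + rho2 * sigma ^+ m * \int[P]_w (enorm (ur w) ^+ m)) => h h1.
apply: le_trans (fsm_lip x h) _; rewrite ler_wpM2r ?enorm_ge0// lerD2r lerD2l.
by rewrite ler_piMr// exprn_ile1 ?enorm_ge0.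
Qed.

Local Notation A := (cA d m R1 R2 sigma).
Local Notation B := (cB d m R1 sigma).
Local Notation C := (cC d m R1 sigma).

Lemma cB_ge0 : 0 <= B.
Proof.
by rewrite /cB !mulr_ge0 ?sqrtr_ge0 ?invr_ge0 ?exprz_ge0 ?(SPB_R1_ge0 fspb)// ltW.
Qed.

Lemma cC_ge0 : 0 <= C.
Proof.
by rewrite /cC !mulr_ge0 ?sqrtr_ge0 ?invr_ge0 ?exprz_ge0 ?(SPB_R1_ge0 fspb)// ltW.
Qed.

Lemma cA_ge0 : 0 <= A.
Proof.
rewrite /cA addr_ge0 ?mulr_ge0 ?sqrtr_ge0 ?invr_ge0 ?exprz_ge0 ?(SPB_R1_ge0 fspb)//
  ?powR_ge0//.
- exact: ltW.
- exact: ltW.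
- exact: ltW (SPB_R2_gt0 fspb).
Qed.

Lemma dfsm_lip x h b : `|dfsm (x + h) b - dfsm x b| <=
  (A + B * enorm x ^+ m + C * enorm h ^+ m) * enorm h * enorm b.
Proof.
(* The same noise is used at both points; the leftover (f(x + h) - f(x)) <u, b> has mean zero. *)
pose G w := (f (x + h + sigma *: ur w) - f (x + sigma *: ur w)) * dotp (ur w) b.
have iG : intg P G.
  have := intgD (intgB (intg_dfd (x + h) b) (intg_dfd x b))
    (intgZ (f (x + h) - f x) (intg_dotp b)).
  by congr intg; apply/funext => w; rewrite /G; ring.
have -> : dfsm (x + h) b - dfsm x b = sigma^-1 * \int[P]_w G w.
  rewrite /dfsm -mulrBr -RintB; [|exact: intg_dfd|exact: intg_dfd].
  congr (_ * _); transitivity (\int[P]_w (G w - (f (x + h) - f x) * dotp (ur w) b)).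
    by apply: eq_Rintegral => w _; rewrite /G; ring.
  rewrite RintB//; last by apply: intgZ; exact: intg_dotp.
  by rewrite RintZ ?Rint_dotp ?mulr0 ?subr0//; exact: intg_dotp.
pose k1 := rho2 * enorm x ^+ m + R2 + rho * enorm h ^+ m.
pose k2 := rho2 * sigma ^+ m.
have k20 : 0 <= k2 by rewrite mulr_ge0 ?rho2_ge0// exprn_ge0// ltW.
have k10 : 0 <= k1.
  by rewrite !addr_ge0 ?mulr_ge0 ?exprz_ge0 ?(SPB_R1_ge0 fspb) ?exprn_ge0 ?enorm_ge0
    ?(ltW (SPB_R2_gt0 fspb))//.
have : `|\int[P]_w G w| <= (enorm h * enorm b) *
    (k1 * \int[P]_w (enorm (ur w) ^+ 1) + k2 * \int[P]_w (enorm (ur w) ^+ m.+1)).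
  rewrite -RintZ// -[X in _ + X]RintZ// -RintD; [|exact: intgZ|exact: intgZ].
  rewrite -RintZ; last by apply: intgD; exact: intgZ.
  apply: Rint_norm_le => //; first by apply: intgZ; apply: intgD; exact: intgZ.
  move=> w; rewrite normrM.
  apply: le_trans (ler_pM _ _ (fdiff_le x h (ur w)) (normr_dotp_le _ _)) _ => //.
  by rewrite le_eqVlt; apply/orP; left; apply/eqP; rewrite /k1 /k2 !exprS expr0; ring.
have m1 := moment1 nu iu; have m2 := moment nu iu m.+1.
have h1 : \int[P]_w (enorm (ur w) ^+ 1) <= Num.sqrt d%:R by [].
set e1 := \int[P]_w (enorm (ur w) ^+ 1) in h1 *.
set e2 := \int[P]_w (_ ^+ m.+1) in m2 *.
move=> hG; rewrite normrM normfV (gtr0_norm s0) ler_pdivrMl//.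
apply: le_trans hG _.
(* A, B and C are precisely what the bounds on E|u| and E|u|^(m+1) leave after division by sigma. *)
have -> : sigma * ((A + B * enorm x ^+ m + C * enorm h ^+ m) * enorm h * enorm b) =
  enorm h * enorm b * (k1 * Num.sqrt d%:R + k2 * (m.+1 + d)%:R `^ (m.+1%:R / 2)).
  rewrite /cA addn1 /cB /cC /k1 /k2.
  have -> : sigma ^ (m%:Z - 1) = sigma ^+ m / sigma.
    by rewrite expfzDr ?gt_eqF// exprz_inv expr1z.
  by field; rewrite gt_eqF.
rewrite ler_wpM2l ?mulr_ge0 ?enorm_ge0//.
by rewrite lerD// ler_wpM2l.
Qed.

Lemma econt_dfsm b : econt (dfsm^~ b).
Proof.
apply: econt_lipschitz => x.
exists ((A + B * enorm x ^+ m + C) * enorm b) => h h1.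
apply: le_trans (dfsm_lip x h b) _; rewrite mulrAC.
rewrite ler_wpM2r ?enorm_ge0// ler_wpM2r ?enorm_ge0// lerD2l.
by rewrite ler_piMr ?cC_ge0// exprn_ile1 ?enorm_ge0.
Qed.

Lemma fsm_quadratic y h : exists K, forall s, `|s| <= 1 ->
  `|fsm (y + s *: h) - fsm y - s * dfsm y h| <= K * s ^+ 2.
Proof.
(* Q bounds f_sigma - M along the segment |s| <= 1, so k Q s^2 controls either use of [fsm_lower]; L
   s^2 is the cost of moving the derivative from y + s h back to y. *)
pose Q := fsm y - M + (rho2 * enorm y ^+ m + R2 + rho * enorm h ^+ m
   + rho2 * sigma ^+ m * \int[P]_w (enorm (ur w) ^+ m)) * enorm h.
pose k := enorm h ^+ 2 / (2 * sigma ^+ 2).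
have k0 : 0 <= k by rewrite divr_ge0 ?sqr_ge0// mulr_ge0 ?sqr_ge0.
pose L := (A + B * enorm y ^+ m + C * enorm h ^+ m) * enorm h * enorm h.
exists (k * Q + L) => s s1.
have sh : enorm (s *: h) <= enorm h by rewrite enormZ ler_piMl ?enorm_ge0.
have shm : enorm (s *: h) ^+ m <= enorm h ^+ m by rewrite lerXn2r ?nnegrE ?enorm_ge0.
have sh2 : enorm (s *: h) ^+ 2 = s ^+ 2 * enorm h ^+ 2.
  by rewrite enormZ exprMn real_normK ?num_real.
have lip : fsm (y + s *: h) - M <= Q.
  have := fsm_lip y (s *: h); rewrite ler_norml => /andP[_ e].
  suff : (rho2 * enorm y ^+ m + R2 + rho * enorm (s *: h) ^+ m
   + rho2 * sigma ^+ m * \int[P]_w (enorm (ur w) ^+ m)) * enorm (s *: h) <=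
   (rho2 * enorm y ^+ m + R2 + rho * enorm h ^+ m
   + rho2 * sigma ^+ m * \int[P]_w (enorm (ur w) ^+ m)) * enorm h by rewrite /Q; lra.
  apply: ler_pM => //; rewrite ?enorm_ge0//; last by rewrite lerD2r lerD2l ler_wpM2l.
  rewrite !addr_ge0 ?mulr_ge0 ?exprz_ge0 ?(SPB_R1_ge0 fspb) ?exprn_ge0 ?enorm_ge0 ?(ltW
    (SPB_R2_gt0 fspb)) ?(ltW s0)//.
  by apply: Rintegral_ge0 => w _; rewrite exprn_ge0 ?enorm_ge0.
have e1 := fsm_lower y (s *: h).
have e2 := fsm_lower (y + s *: h) (- (s *: h)).
have e3 := dfsm_lip y (s *: h) h.
have Ly : (A + B * enorm y ^+ m + C * enorm (s *: h) ^+ m) * enorm (s *: h) * enorm h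
    <= `|s| * L.
  have -> : `|s| * L =
      (A + B * enorm y ^+ m + C * enorm h ^+ m) * enorm (s *: h) * enorm h.
    by rewrite /L enormZ; ring.
  by rewrite !ler_wpM2r ?enorm_ge0// lerD2l ler_wpM2l ?cC_ge0.
have {}e3 := le_trans e3 Ly.
rewrite addrK -scaleNr enormZ normrN -enormZ !dfsmZ sh2 in e2.
rewrite dfsmZ sh2 in e1.
have kE : s ^+ 2 * enorm h ^+ 2 / (2 * sigma ^+ 2) = k * s ^+ 2 by rewrite /k; ring.
rewrite kE in e1 e2.
have fy : fsm y - M <= Q.
  rewrite /Q lerDl mulr_ge0 ?enorm_ge0//.
  rewrite !addr_ge0 ?mulr_ge0 ?exprz_ge0 ?(SPB_R1_ge0 fspb) ?exprn_ge0 ?enorm_ge0 ?(ltW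
    (SPB_R2_gt0 fspb)) ?(ltW s0)//.
  by apply: Rintegral_ge0 => w _; rewrite exprn_ge0 ?enorm_ge0.
have L0 : 0 <= L.
  have hB : 0 <= B * enorm y ^+ m by apply: mulr_ge0 cB_ge0 _; rewrite exprn_ge0 ?enorm_ge0.
  have hC : 0 <= C * enorm h ^+ m by apply: mulr_ge0 cC_ge0 _; rewrite exprn_ge0 ?enorm_ge0.
  by do 2 apply: mulr_ge0 (enorm_ge0 _); have := cA_ge0; lra.
have ks0 : 0 <= k * s ^+ 2 by rewrite mulr_ge0 ?sqr_ge0.
have b1 : k * s ^+ 2 * (fsm y - M) <= k * s ^+ 2 * Q by rewrite ler_wpM2l.
have b2 : k * s ^+ 2 * (fsm (y + s *: h) - M) <= k * s ^+ 2 * Q by rewrite ler_wpM2l.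
have b3 : `|s * (dfsm (y + s *: h) h - dfsm y h)| <= L * s ^+ 2.
  rewrite normrM -(real_normK (num_real s)) expr2 mulrCA.
  by rewrite ler_wpM2l// mulrC.
have Ls : 0 <= L * s ^+ 2 by rewrite mulr_ge0 ?sqr_ge0.
move: b3; rewrite !ler_norml => /andP[b3 b4]; apply/andP; split; lra.
Qed.

Lemma grad_fsm x : grad fsm x = gradsm x.
Proof.
apply/rowP => i; rewrite !mxE; have [K hK] := fsm_quadratic x (evec i).
by have /@derive_val := is_derive_quadratic hK.
Qed.

Lemma descent x h : fsm (x + h) <= fsm x + dfsm x h
  + (A + B * enorm x ^+ m) / 2 * enorm h ^+ 2 + C / (m + 2)%:R * enorm h ^+ (m + 2).
Proof.
pose a := (A + B * enorm x ^+ m) * enorm h ^+ 2.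
pose c := C * enorm h ^+ (m + 2).
(* The integrated bound as a polynomial: psi - p has nonpositive derivative on [0, 1], so the mean
   value theorem replaces an integral. *)
pose p : {poly R} := dfsm x h *: 'X + (a / 2) *: 'X^2 + (c / (m + 2)%:R) *: 'X^(m + 2).
pose psi t := fsm (x + t *: h).
have dpsi (t : R) : is_derive t 1 psi (dfsm (x + t *: h) h).
  have [K hK] := fsm_quadratic (x + t *: h) h.
  apply: (@is_derive_quadratic _ _ _ _ _ _ K) => s s1.
  by rewrite /psi [s *: 1]mulr1 scalerDl addrA; exact: hK.
have dphi (t : R) : is_derive t 1 (psi - horner p) (dfsm (x + t *: h) h - p^`().[t]).
  exact: is_deriveB.
have cphi : {within `[0, 1], continuous (psi - horner p)}.
  by apply: derivable_within_continuous => t _; case: (dphi t).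
have [t t01] := MVT ltr01 (fun t _ => dphi t) cphi.
have t0 : 0 <= t by move: t01; rewrite in_itv/= => /andP[/ltW].
have pE s : p.[s] = dfsm x h * s + a / 2 * s ^+ 2 + c / (m + 2)%:R * s ^+ (m + 2).
  by rewrite /p !hornerE.
have dpE : p^`().[t] = dfsm x h + a * t + c * t ^+ m.+1.
  rewrite /p !derivD !derivZ derivX !derivXn !hornerE/= addn2 /=.
  rewrite hornerMn hornerXn -[t ^+ _ *+ _]mulr_natl mulrA divfK ?pnatr_eq0//.
  by congr (_ + _ + _); field.
have phiE s : (psi - horner p) s = psi s - p.[s] by [].
have p1 : p.[1] = dfsm x h + a / 2 + c / (m + 2)%:R by rewrite pE !expr1n !mulr1.
have p0 : p.[0] = 0 by rewrite pE !expr0n addn2/= !mulr0 !addr0.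
rewrite !phiE p1 p0 dpE /psi scale1r scale0r addr0 !subr0 mulr1 => e.
have := dfsm_lip x (t *: h) h;
  rewrite enormZ (ger0_norm t0) exprMn ler_norml => /andP[_ e'].
have : dfsm (x + t *: h) h - dfsm x h <= a * t + c * t ^+ m.+1.
  apply: le_trans e' _; rewrite le_eqVlt; apply/orP; left; apply/eqP.
  by rewrite /a /c addn2 !exprS expr0; ring.
rewrite addn2 in e *.
have -> : (A + B * enorm x ^+ m) / 2 * enorm h ^+ 2 = a / 2 by rewrite /a; ring.
have -> : C / m.+2%:R * enorm h ^+ m.+2 = c / m.+2%:R by rewrite /c addn2; ring.
move: e; set z1 := a * t; set z2 := c * t ^+ _; set z3 := c / _; set z4 := a / 2.
by clearbody z1 z2 z3 z4; lra.
Qed.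

End smoothing.

(** * One step of the method *)

(** With q = |x|^m, this lets the stepsize factor 1/(|x|^(2m) + 1), raised to the power m + 2,
    absorb the moment of order m + 2. *)
Lemma expr_add1_le {R : realType} (q : R) m : 0 <= q ->
  q ^+ m.+2 + 1 <= (q ^+ 2 + 1) ^+ m.+2.
Proof.
move=> q0; have n1 : 1 <= q ^+ 2 + 1 by rewrite lerDr sqr_ge0.
have qn : q <= q ^+ 2 + 1 by nra.
have h1 : q ^+ m.+1 <= (q ^+ 2 + 1) ^+ m.+1.
  by rewrite lerXn2r ?nnegrE//; lra.
have h2 : 1 <= (q ^+ 2 + 1) ^+ m.+1 by rewrite exprn_ege1.
have [q1|q1] := leP q 1.
  have : q ^+ m.+2 <= q ^+ 2.
    by rewrite -[m.+2]addn2 addnC exprD ler_piMr ?sqr_ge0// exprn_ile1.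
  move=> h; rewrite [leRHS]exprS; apply: le_trans (lerD h (lexx 1)) _.
  by rewrite ler_peMr//; lra.
rewrite [leLHS]addrC exprS [leRHS]exprS.
have : 1 + q * q ^+ m.+1 <= (1 + q) * (q ^+ 2 + 1) ^+ m.+1.
  by rewrite mulrDl mul1r lerD// ler_wpM2l.
have : (1 + q) * (q ^+ 2 + 1) ^+ m.+1 <= (q ^+ 2 + 1) * (q ^+ 2 + 1) ^+ m.+1.
  by rewrite ler_wpM2r; [|lra|nra].
lra.
Qed.

Section one_step.
Context {R : realType} {d : nat} {dT : measure_display} {T : measurableType dT}.
Context (P : probability T R) (u : 'I_d -> T -> R).
Hypothesis nu : forall i, std_normal P (u i).
Hypothesis iu : mutually_independent P u.
Local Notation ur w := (\row_i u i w).
Variables (m : nat) (f : 'rV[R]_d -> R) (R1 R2 sigma M : R).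
Hypothesis fspb : SPB f R1 R2 m.
Hypothesis s0 : 0 < sigma.
Hypothesis fM : forall x, M <= f x.

Local Notation rho := ((2 : R) ^ (m%:Z - 1) * R1).
Local Notation A := (cA d m R1 R2 sigma).
Local Notation B := (cB d m R1 sigma).
Local Notation C := (cC d m R1 sigma).
Local Notation H := (cH d m R1 R2 sigma).
Local Notation fsm := (fsm P u f sigma).
Local Notation dfsm := (dfsm P u f sigma).
Local Notation gradsm := (gradsm P u f sigma).

Definition sdir (x a : 'rV[R]_d) := (sigma^-1 * (f (x + sigma *: a) - f x)) *: a.
Definition step (t : R) (x a : 'rV[R]_d) :=
  x - (t / (enorm x ^+ (2 * m) + 1)) *: sdir x a.

Let rho0 : 0 <= rho := SPB_rho_ge0 fspb.
Let R2ge : 0 <= R2 := ltW (SPB_R2_gt0 fspb).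

Lemma enorm_sdir_le x a : enorm (sdir x a) <=
  (rho * enorm x ^+ m + rho * sigma ^+ m * enorm a ^+ m + R2) * enorm a ^+ 2.
Proof.
rewrite /sdir enormZ normrM normfV (gtr0_norm s0) -[leLHS]mulrA ler_pdivrMl//.
apply: le_trans (ler_wpM2r (enorm_ge0 _) (df_le fspb s0 x a)) _.
by rewrite le_eqVlt; apply/orP; left; apply/eqP; rewrite !exprS expr0; ring.
Qed.

Lemma enorm_sdir_expr_le x a p : enorm (sdir x a) ^+ p.+1 <=
  3 ^+ p * (rho ^+ p.+1 * enorm x ^+ (m * p.+1) + R2 ^+ p.+1) * enorm a ^+ (2 * p.+1)
  + 3 ^+ p * (rho ^+ p.+1 * sigma ^+ (m * p.+1)) * enorm a ^+ ((m + 2) * p.+1).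
Proof.
apply: (@le_trans _ _ (((rho * enorm x ^+ m + rho * sigma ^+ m * enorm a ^+ m + R2)
    * enorm a ^+ 2) ^+ p.+1)).
  by rewrite lerXn2r ?nnegrE ?enorm_ge0 ?(le_trans (enorm_ge0 _) (enorm_sdir_le x a))//
    enorm_sdir_le.
rewrite exprMn.
have e0 : 0 <= (enorm a ^+ 2) ^+ p.+1 by rewrite !exprn_ge0 ?enorm_ge0.
have a1 : 0 <= rho * enorm x ^+ m by rewrite mulr_ge0// exprn_ge0 ?enorm_ge0.
have a2 : 0 <= rho * sigma ^+ m * enorm a ^+ m.
  by rewrite !mulr_ge0 ?exprn_ge0 ?enorm_ge0 ?(ltW s0)// ?exprz_ge0 ?(SPB_R1_ge0 fspb).
apply: le_trans (ler_wpM2r e0 (expr3_convex p a1 a2 R2ge)) _.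
rewrite mulnDl exprD !(exprM _ m) (exprM _ 2) !exprMn.
by rewrite le_eqVlt; apply/orP; left; apply/eqP; ring.
Qed.

Lemma vmeas_sdir x i : vmeas (fun a => sdir x a 0 i).
Proof.
rewrite (_ : (fun a => _) = fun a => sigma^-1 * (f (x + sigma *: a) - f x) * a 0 i);
  last first.
  by apply/funext => a; rewrite mxE.
apply: vmeasM (vmeas_coord i); apply: vmeasM (vmeas_cst _) _.
by apply: vmeasB (vmeas_cst _); exact: vmeas_affine (vmeas_SPB fspb).
Qed.

Lemma measurable_sdir_expr x p : measurable_fun setT (fun w => enorm (sdir x (ur w)) ^+ p).
Proof.
apply: (measurable_gauss nu (g := fun a => enorm (sdir x a) ^+ p)); apply: vmeasX.
exact: (vmeas_comp vmeas_enorm (vmeas_sdir x)).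
Qed.

Let mom q := moment_intg nu iu q.

Lemma intg_sdir x p : intg P (fun w => enorm (sdir x (ur w)) ^+ p.+1).
Proof.
apply: (@intg_dom _ _ _ _ _ (fun w =>
  3 ^+ p * (rho ^+ p.+1 * enorm x ^+ (m * p.+1) + R2 ^+ p.+1) * enorm (ur w) ^+ (2 * p.+1)
  + 3 ^+ p * (rho ^+ p.+1 * sigma ^+ (m * p.+1)) * enorm (ur w) ^+ ((m + 2) * p.+1))).
- exact: measurable_sdir_expr.
- by move=> w; rewrite ger0_norm ?exprn_ge0 ?enorm_ge0//; exact: enorm_sdir_expr_le.
- by apply: intgD; apply: intgZ; exact: mom.
Qed.

Lemma rhoX p : rho ^+ p = (2 : R) ^ ((m%:Z - 1) * p%:Z) * R1 ^+ p.
Proof. by rewrite exprMn exprnP -exprz_exp. Qed.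

Lemma cH_ge0 p : 0 <= H p.
Proof.
rewrite /cH mulr_ge0 ?exprn_ge0// le_max; apply/orP; left.
by rewrite !mulr_ge0 ?exprn_ge0 ?exprz_ge0 ?(SPB_R1_ge0 fspb).
Qed.

(** The two arguments of the maximum in H are the coefficient of |x|^(mp) and the constant term of
    the resulting bound. *)
Lemma Rint_sdir_le x p : \int[P]_w (enorm (sdir x (ur w)) ^+ p.+1) <=
  H p.+1 * (enorm x ^+ (m * p.+1) + 1).
Proof.
set X := enorm x ^+ (m * p.+1).
have X0 : 0 <= X by rewrite exprn_ge0 ?enorm_ge0.
apply: (@le_trans _ _
  (3 ^+ p * (rho ^+ p.+1 * X + R2 ^+ p.+1) * \int[P]_w (enorm (ur w) ^+ (2 * p.+1))
  + 3 ^+ p * (rho ^+ p.+1 * sigma ^+ (m * p.+1)) * \int[P]_w (enorm (ur w) ^+ ((m + 2) *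
      p.+1)))).
  rewrite -(RintZ _ (mom _)) -(RintZ _ (mom _)) -RintD; [|exact: intgZ|exact: intgZ].
  apply: Rint_le; [exact: intg_sdir|by apply: intgD; exact: intgZ|].
  by move=> w; exact: enorm_sdir_expr_le.
have m1 := moment_even nu iu p.+1; have m2 := moment nu iu ((m + 2) * p.+1).
set e1 := \int[P]_w _ in m1 *; set e2 := \int[P]_w _ in m2 *.
have r0 : 0 <= rho ^+ p.+1 by rewrite exprn_ge0.
have R20 : 0 <= R2 ^+ p.+1 by rewrite exprn_ge0.
have sp0 : 0 <= sigma ^+ (m * p.+1) by rewrite exprn_ge0// ltW.
have t0 : 0 <= 3 ^+ p :> R by rewrite exprn_ge0.
rewrite /cH -rhoX /= -mulrA -[X in X <= _]/(_) -[leRHS]mulrA.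
rewrite -[X in _ + X]mulrA -mulrDr ler_wpM2l//.
set b1 := (2 * p.+1 + d)%:R ^+ p.+1 in m1 *; set b2 := _ `^ _ in m2 *.
set mx := Num.max _ _.
have h1 : rho ^+ p.+1 * b1 <= mx by rewrite le_max lexx.
have h2 : R2 ^+ p.+1 * b1 + rho ^+ p.+1 * sigma ^+ (m * p.+1) * b2 <= mx.
  by rewrite le_max lexx orbT.
apply: (@le_trans _ _ ((rho ^+ p.+1 * X + R2 ^+ p.+1) * b1
    + rho ^+ p.+1 * sigma ^+ (m * p.+1) * b2)).
  apply: lerD; first by rewrite ler_wpM2l// addr_ge0// mulr_ge0.
  by rewrite ler_wpM2l// mulr_ge0.
have : X * (rho ^+ p.+1 * b1) <= X * mx by rewrite ler_wpM2l.
rewrite mulrDl mulrDr mulr1 (mulrC mx X).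
have -> : rho ^+ p.+1 * X * b1 = X * (rho ^+ p.+1 * b1) by ring.
lra.
Qed.

Definition descent_gap (t : R) : R :=
  H 2 * t ^+ 2 * (A + B) / 2 + C / (m + 2)%:R * H (m + 2) * t ^+ (m + 2).

Lemma vmeas_step t x i : vmeas (fun a => step t x a 0 i).
Proof.
rewrite (_ : (fun a => _) = fun a =>
    x 0 i - t / (enorm x ^+ (2 * m) + 1) * sdir x a 0 i); last first.
  by apply/funext => a; rewrite /step !mxE.
by apply: vmeasB (vmeas_cst _) _; apply: vmeasM (vmeas_cst _) (vmeas_sdir x i).
Qed.

Lemma vmeas_fsm : vmeas fsm.
Proof. exact: econt_vmeas (econt_fsm nu iu fspb s0). Qed.

(** The integrand is nonnegative and its integral extended-real, so the bound also serves to derive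
    integrability after the step. *)
Lemma one_step t x : 0 < t ->
  (\int[P]_w (fsm (step t x (ur w)) - M
     + t * (enorm (gradsm x) ^+ 2 / (enorm x ^+ m + 1) ^+ 2))%:E
   <= (fsm x - M + descent_gap t)%:E)%E.
Proof.
move=> t0; set q := enorm x ^+ m; set n := enorm x ^+ (2 * m) + 1.
have q0 : 0 <= q by rewrite exprn_ge0 ?enorm_ge0.
have nE : n = q ^+ 2 + 1 by rewrite /n mulnC exprM.
have n0 : 0 < n by rewrite nE; nra.
pose c := t / n; have c0 : 0 < c by rewrite divr_gt0.
pose G := gradsm x; pose g2 := enorm G ^+ 2.
have g20 : 0 <= g2 by rewrite sqr_ge0.
pose a1 := (A + B * q) / 2 * c ^+ 2; pose a2 := C / (m + 2)%:R * c ^+ (m + 2).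
have hA := cA_ge0 fspb s0; have hB := cB_ge0 fspb s0; have hC := cC_ge0 fspb s0.
have a10 : 0 <= a1.
  apply: mulr_ge0; last by rewrite sqr_ge0.
  have : 0 <= B * q by exact: mulr_ge0 hB q0.
  lra.
have a20 : 0 <= a2.
  by apply: mulr_ge0; [apply: divr_ge0; [exact: hC|]|rewrite exprn_ge0// ltW].
pose k := fsm x - M + t * (g2 / (q + 1) ^+ 2).
pose X w := (f (x + sigma *: ur w) - f x) * dotp (ur w) G.
pose Y w := (k - c * sigma^-1 * X w)
  + (a1 * enorm (sdir x (ur w)) ^+ 2 + a2 * enorm (sdir x (ur w)) ^+ (m + 2)).
have iX : intg P X by exact: (intg_dfd nu iu fspb s0).
have i2 : intg P (fun w => enorm (sdir x (ur w)) ^+ 2) by exact: intg_sdir.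
have i3 : intg P (fun w => enorm (sdir x (ur w)) ^+ (m + 2)) by rewrite addn2;
  exact: intg_sdir.
have j1 : intg P (fun w => k - c * sigma^-1 * X w).
  by apply: intgB; [exact: intg_cst|exact: intgZ].
have j2 : intg P (fun w => a1 * enorm (sdir x (ur w)) ^+ 2
    + a2 * enorm (sdir x (ur w)) ^+ (m + 2)).
  by apply: intgD; exact: intgZ.
have iY : intg P Y by exact: intgD.
have g2E : sigma^-1 * \int[P]_w X w = g2.
  by rewrite -/(dfsm x G) -(dotp_gradsm nu iu fspb s0) -enorm_sqr.
have le1 w : fsm (step t x (ur w)) - M + t * (g2 / (q + 1) ^+ 2) <= Y w.
  have := descent nu iu fspb s0 fM x (- (c *: sdir x (ur w))).
  rewrite enormN enormZ (gtr0_norm c0) (exprMn 2 c) (exprMn (m + 2) c) -/q.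
  have dE : dotp G (sdir x (ur w)) = sigma^-1 * X w.
    by rewrite /sdir dotpZr (dotpC G) /X mulrA.
  rewrite -(dotp_gradsm nu iu fspb s0) -/G dotpNr dotpZr dE (mulrA c).
  rewrite /Y /a1 /a2 /k /step -/n -/c.
  have -> : (A + B * q) / 2 * (c ^+ 2 * enorm (sdir x (ur w)) ^+ 2) =
    (A + B * q) / 2 * c ^+ 2 * enorm (sdir x (ur w)) ^+ 2 by ring.
  have -> : C / (m + 2)%:R * (c ^+ (m + 2) * enorm (sdir x (ur w)) ^+ (m + 2)) =
    C / (m + 2)%:R * c ^+ (m + 2) * enorm (sdir x (ur w)) ^+ (m + 2) by ring.
  set z1 := _ * enorm _ ^+ 2; set z2 := _ * enorm _ ^+ (m + 2); set z3 := t * _.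
  by clearbody z1 z2 z3; lra.
apply: (@le_trans _ _ (\int[P]_w (Y w)%:E)%E).
  apply: ge0_le_integral => //.
  - move=> w _; rewrite lee_fin addr_ge0 ?subr_ge0 ?(fsm_ge nu iu fspb s0 fM)//.
    by rewrite mulr_ge0 ?(ltW t0)// divr_ge0 ?sqr_ge0.
  - apply/measurable_EFinP; apply: measurable_funD => //; apply: measurable_funB => //.
    apply: (measurable_gauss nu (g := fun a => fsm (step t x a))).
    exact: (vmeas_comp vmeas_fsm (vmeas_step t x)).
  - by apply/measurable_EFinP; exact: intg_meas iY.
  - by move=> w _; rewrite lee_fin; exact: le1.
rewrite (intgE iY) lee_fin (RintD j1 j2) (RintB (intg_cst P k) (intgZ _ iX)) Rint_cst.
rewrite (RintZ _ iX) -mulrA g2E (RintD (intgZ _ i2) (intgZ _ i3)) (RintZ _ i2) (RintZ _ i3).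
have b2 := Rint_sdir_le x 1; have b3 := Rint_sdir_le x m.+1.
rewrite -addn2 in b3.
have q2 : enorm x ^+ (m * 2) = q ^+ 2 by rewrite exprM.
have qm : enorm x ^+ (m * (m + 2)) = q ^+ (m + 2) by rewrite exprM.
rewrite q2 -nE in b2; rewrite qm in b3.
have H2 := cH_ge0 2; have Hm := cH_ge0 (m + 2).
(* The second moment cancels one factor n of c^2 = t^2 / n^2; the other gives (A + B q) / n <= A +
   B, as n = q^2 + 1 is at least 1 and at least q. *)
have c1 : a1 * \int[P]_w (enorm (sdir x (ur w)) ^+ 2) <= H 2 * t ^+ 2 * (A + B) / 2.
  apply: le_trans (ler_wpM2l a10 b2) _.
  have -> : a1 * (H 2 * n) = H 2 * t ^+ 2 / 2 * ((A + B * q) / n).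
    by rewrite /a1 /c; field; rewrite gt_eqF.
  rewrite [leRHS](_ : _ = H 2 * t ^+ 2 / 2 * (A + B)); last by field.
  apply: ler_wpM2l; first by rewrite divr_ge0//; exact: mulr_ge0 H2 (sqr_ge0 t).
  rewrite ler_pdivrMr// mulrDl; apply: lerD.
    by apply: ler_peMr; [exact: hA|rewrite nE; nra].
  by apply: ler_wpM2l; [exact: hB|rewrite nE; nra].
have c2 : a2 * \int[P]_w (enorm (sdir x (ur w)) ^+ (m + 2)) <=
    C / (m + 2)%:R * H (m + 2) * t ^+ (m + 2).
  apply: le_trans (ler_wpM2l a20 b3) _.
  have -> : a2 * (H (m + 2) * (q ^+ (m + 2) + 1)) =
      C / (m + 2)%:R * H (m + 2) * t ^+ (m + 2) * ((q ^+ (m + 2) + 1) / n ^+ (m + 2)).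
    by rewrite /a2 /c expr_div_n; ring.
  apply: ler_piMr.
    apply: mulr_ge0; last by rewrite exprn_ge0// ltW.
    by apply: mulr_ge0 => //; apply: divr_ge0 => //; exact: hC.
  by rewrite ler_pdivrMr ?exprn_gt0// mul1r nE addn2 expr_add1_le.
(* Because q^2 + 1 <= (q + 1)^2. *)
have c3 : t * (g2 / (q + 1) ^+ 2) <= c * g2.
  rewrite /c -[leRHS]mulrA (mulrC n^-1) ler_wpM2l ?(ltW t0)// ler_wpM2l//.
  by rewrite lef_pV2 ?posrE// ?exprn_gt0; nra.
rewrite /descent_gap /k; lra.
Qed.

End one_step.

(** * The iterates *)

Section process.
Context {R : realType} {d : nat}.
Variables (m : nat) (f : 'rV[R]_d -> R) (R1 R2 sigma : R).
Hypothesis fspb : SPB f R1 R2 m.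

Lemma vmeas_stepsize : vmeas (fun x : 'rV[R]_d => (enorm x ^+ (2 * m) + 1)^-1).
Proof.
apply: vmeasV => [|a]; last by rewrite ltr_wpDl// mulnC exprM sqr_ge0.
by apply: vmeasD (vmeas_cst _); apply: vmeasX vmeas_enorm.
Qed.

Lemma measurable_step dS (S : measurableType dS) (X Y : 'I_d -> S -> R) t i :
  (forall i, measurable_fun setT (X i)) -> (forall i, measurable_fun setT (Y i)) ->
  measurable_fun setT (fun s => step m f sigma t (\row_i X i s) (\row_i Y i s) 0 i).
Proof.
move=> mX mY.
rewrite (_ : (fun s => _) = fun s => X i s -
    t * (enorm (\row_i X i s) ^+ (2 * m) + 1)^-1 *
    (sigma^-1 * (f (\row_i (X i s + sigma * Y i s)) - f (\row_i X i s)) * Y i s));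
      last first.
  apply/funext => s; rewrite /step /sdir !mxE; congr (_ - _ * (_ * (f _ - _) * _)).
  by apply/rowP => j; rewrite !mxE.
apply: measurable_funB => //; apply: measurable_funM.
  by apply: measurable_funM => //; exact: (vmeas_stepsize mX).
apply: measurable_funM => //; apply: measurable_funM => //; apply: measurable_funB.
  apply: (vmeas_SPB fspb) => j.
  by apply: measurable_funD => //; exact: measurable_funM.
exact: (vmeas_SPB fspb).
Qed.

(** Only noise before step k is assumed measurable, on an arbitrary space: with the sigma-algebra of
    the past on the sample space, this says that the iterates are adapted. *)
Lemma measurable_iter_x dS (S : measurableType dS) x0 tau (U : nat -> 'I_d -> S -> R) k :
  (forall j i, (j < k)%N -> measurable_fun setT (U j i)) ->
  forall i, measurable_fun setT (fun w => iter_x f m sigma x0 tau U k w 0 i).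
Proof.
elim: k => [|k ih] mU i; first exact: measurable_cst.
have mX := ih (fun j i jk => mU j i (ltnW jk)).
have := @measurable_step _ S (fun i w => iter_x f m sigma x0 tau U k w 0 i) (U k)
  (tau k) i mX (fun i => mU k i (ltnSn k)).
congr (measurable_fun _ _); apply/funext => w.
suff -> : \row_j iter_x f m sigma x0 tau U k w 0 j = iter_x f m sigma x0 tau U k w by [].
by apply/rowP => j; rewrite mxE.
Qed.

End process.

Section chain.
Context {R : realType} {d : nat} {dT : measure_display} {T : measurableType dT}.
Context (P : probability T R) (U : nat -> 'I_d -> T -> R).
Variables (m : nat) (f : 'rV[R]_d -> R) (R1 R2 sigma M : R).
Variables (x0 : 'rV[R]_d) (tau : nat -> R).
Hypothesis fspb : SPB f R1 R2 m.
Hypothesis s0 : 0 < sigma.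
Hypothesis fM : forall x, M <= f x.
Hypothesis tau0 : forall k, 0 < tau k.
Hypothesis nU : forall k i, std_normal P (U k i).
Hypothesis iU : mutually_independent P (fun ki : nat * 'I_d => U ki.1 ki.2).

Lemma indep_layer k : mutually_independent P (U k).
Proof.
move=> J A uJ mA.
have := iU (J := [seq (k, i) | i <- J]) (A := fun ki => A ki.2).
rewrite big_map/= map_inj_uniq ?uJ; last by move=> i j [].
move=> <-//; last by move=> _ /mapP[i iJ ->]; exact: mA.
congr (P _); apply/seteqP; split => w /= h.
  by move=> _ /mapP[i iJ ->]; exact: h.
by move=> i iJ; apply: (h (k, i)); apply/mapP; exists i.
Qed.

Local Notation fs := (fsm P (U 0%N) f sigma).
Local Notation X := (iter_x f m sigma x0 tau U).
Local Notation gap := (@descent_gap R d m R1 R2 sigma).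

Definition stat x := enorm (gradsm P (U 0%N) f sigma x) ^+ 2 / (enorm x ^+ m + 1) ^+ 2.

Let nu0 := nU 0%N.
Let iu0 := indep_layer 0%N.

Lemma stat_ge0 x : 0 <= stat x.
Proof. by rewrite divr_ge0 ?sqr_ge0. Qed.

Lemma vmeas_stat : vmeas stat.
Proof.
apply: vmeasM.
  apply: vmeasX; apply: (vmeas_comp vmeas_enorm) => i.
  rewrite (_ : (fun a => _) = dfsm P (U 0%N) f sigma ^~ (evec i)).
    exact: econt_vmeas (econt_dfsm nu0 iu0 fspb s0 _).
  by apply/funext => a; rewrite mxE.
apply: vmeasV => [|a]; last first.
  by rewrite exprn_gt0// ltr_wpDl// exprn_ge0 ?enorm_ge0.
by apply: vmeasX; apply: vmeasD (vmeas_cst _); exact: vmeasX vmeas_enorm.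
Qed.

Let rowX k w : \row_i X k w 0 i = X k w.
Proof. by apply/rowP => i; rewrite mxE. Qed.

Lemma measurable_vmeas_iter g k : vmeas g -> measurable_fun setT (fun w => g (X k w)).
Proof.
move=> mg; apply: (vmeas_measurable mg).
by apply: (measurable_iter_x _ fspb) => j i _; case: (nU j i).
Qed.

Lemma chain_step k :
  (\int[P]_w (fs (X k.+1 w) - M)%:E + (tau k)%:E * \int[P]_w (stat (X k w))%:E
   <= \int[P]_w (fs (X k w) - M)%:E + (gap (tau k))%:E)%E.
Proof.
have fs_ge x : 0 <= fs x - M by rewrite subr_ge0; exact: (fsm_ge nu0 iu0 fspb s0 fM).
have mfs : vmeas fs by exact: (vmeas_fsm nu0 iu0 fspb s0).
(* [J1] indexes the noise that determines x^k, [J2] the fresh noise of step k. *)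
pose J1 := [seq (j, i) | j <- iota 0 k, i <- enum 'I_d].
pose J2 := [seq (k, i) | i <- enum 'I_d].
have J12 : ~~ has (mem J1) J2.
  apply/hasPn => _ /mapP[i _ ->]; apply/negP => /allpairsP[[j l] /= [+ _ [jk _]]].
  by rewrite -jk mem_iota ltnn.
pose UU (ki : nat * 'I_d) := U ki.1 ki.2.
have mUU ki : measurable_fun setT (UU ki) by case: (nU ki.1 ki.2).
pose T1 := g_sigma_algebraType (cylinders UU J1).
pose T2 := g_sigma_algebraType (cylinders UU J2).
have mX1 i : measurable_fun setT (fun w : T1 => X k w 0 i).
  apply: (@measurable_iter_x _ _ _ _ _ _ _ fspb _ T1) => j l jk.
  apply: (measurable_cylinders_coord (X := UU) (j := (j, l))).
  by apply/allpairsP; exists (j, l); rewrite mem_iota mem_enum.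
have mU2 i : measurable_fun setT (fun w : T2 => U k i w).
  apply: (measurable_cylinders_coord (X := UU) (j := (k, i))).
  by apply/mapP; exists i; rewrite ?mem_enum.
have mX12 i : measurable_fun setT (fun z : T1 * T2 => X k z.1 0 i).
  exact: (measurableT_comp (mX1 i) (@measurable_fst _ _ T1 T2)).
have mU12 i : measurable_fun setT (fun z : T1 * T2 => U k i z.2).
  exact: (measurableT_comp (mU2 i) (@measurable_snd _ _ T1 T2)).
(* The sample point is doubled: w drives x^k and w' the new direction. On the diagonal this is the
   true next iterate. *)
pose g w w' := (fs (step m f sigma (tau k) (X k w) (\row_i U k i w')) - M
  + tau k * stat (X k w))%:E.
have g0 w w' : (0 <= g w w')%E.
  by rewrite lee_fin addr_ge0// mulr_ge0 ?stat_ge0 ?(ltW (tau0 k)).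
have mg : measurable_fun setT (fun z : T1 * T2 => g z.1 z.2).
  apply/measurable_EFinP; apply: measurable_funD.
    apply: measurable_funB => //.
    apply: (vmeas_measurable (S := (T1 * T2)%type) mfs) => i.
    have := @measurable_step _ _ m f R1 R2 sigma fspb _ (T1 * T2)%type
      (fun i z => X k z.1 0 i) (fun i z => U k i z.2) (tau k) i mX12 mU12.
    by congr measurable_fun; apply/funext => z; rewrite rowX.
  apply: measurable_funM => //.
  exact: (vmeas_measurable (S := (T1 * T2)%type) vmeas_stat mX12).
have [mI IE] := indep_tonelli mUU iU J12 g0 mg.
(* With x^k frozen, the k-th noise vector is exchanged for the first, for which [fs] is defined, and
   [one_step] applies. *)
have inner w : (\int[P]_w' g w w' <= (fs (X k w) - M + gap (tau k))%:E)%E.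
  pose h a := fs (step m f sigma (tau k) (X k w) a) - M + tau k * stat (X k w).
  rewrite (gauss_same_law (nU k) (indep_layer k) nu0 iu0 (g := h)).
  - exact: (one_step nu0 iu0 fspb s0 fM).
  - apply: vmeasD (vmeas_cst _); apply: vmeasB (vmeas_cst _).
    apply: (vmeas_comp (F := step m f sigma (tau k) (X k w)) mfs) => i.
    exact: vmeas_step fspb _ _ _.
  - by move=> a; rewrite addr_ge0// mulr_ge0 ?stat_ge0 ?(ltW (tau0 k)).
have mstat := measurable_vmeas_iter k vmeas_stat.
have mfX j := measurable_vmeas_iter j mfs.
have gap0 : 0 <= gap (tau k).
  rewrite /descent_gap; apply: addr_ge0.
    apply: divr_ge0 => //; apply: mulr_ge0; last first.
      exact: addr_ge0 (cA_ge0 fspb s0) (cB_ge0 fspb s0).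
    by apply: mulr_ge0; [exact: (cH_ge0 _ fspb)|exact: sqr_ge0].
  apply: mulr_ge0; last by rewrite exprn_ge0// ltW.
  apply: mulr_ge0; last exact: (cH_ge0 _ fspb).
  by apply: divr_ge0; [exact: (cC_ge0 fspb s0)|].
have gapE : (\int[P]_w (gap (tau k))%:E = (gap (tau k))%:E)%E.
  by rewrite integral_cst//= probability_setT mule1.
rewrite -ge0_integralZl//; last 3 first.
- exact/measurable_EFinP.
- by move=> w _; rewrite lee_fin stat_ge0.
- by rewrite lee_fin ltW.
have f0 j w : [set: T] w -> (0 <= (fs (X j w) - M)%:E)%E by rewrite lee_fin.
have mfX' j : measurable_fun setT (fun w => (fs (X j w) - M)%:E).
  by apply/measurable_EFinP; exact: measurable_funB.
have t0 w : [set: T] w -> (0 <= (tau k)%:E * (stat (X k w))%:E)%E.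
  by rewrite lee_fin mulr_ge0 ?stat_ge0// ltW.
have mt : measurable_fun setT (fun w => ((tau k)%:E * (stat (X k w))%:E)%E).
  by apply/measurable_EFinP; exact: measurable_funM.
have p0 w : [set: T] w -> (0 <= (gap (tau k))%:E)%E by rewrite lee_fin.
have mp : measurable_fun [set: T] (fun=> (gap (tau k))%:E) by exact: measurable_cst.
rewrite -gapE -(ge0_integralD P measurableT (f0 k) (mfX' k) p0 mp).
rewrite -(ge0_integralD P measurableT (f0 k.+1) (mfX' k.+1) t0 mt).
apply: (@le_trans _ _ (\int[P]_w g w w)%E); first by [].
rewrite IE; apply: ge0_le_integral => //.
- by move=> w _; exact: integral_ge0.
- apply/measurable_EFinP; apply: measurable_funD; last exact: measurable_cst.
  by apply: measurable_funB.
Qed.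

End chain.

(** * Integrability along the chain and summation *)

Section telescope.
Context {R : realType} {d : nat} {dT : measure_display} {T : measurableType dT}.
Context (P : probability T R) (U : nat -> 'I_d -> T -> R).
Variables (m : nat) (f : 'rV[R]_d -> R) (R1 R2 sigma M : R).
Variables (x0 : 'rV[R]_d) (tau : nat -> R).
Hypothesis fspb : SPB f R1 R2 m.
Hypothesis s0 : 0 < sigma.
Hypothesis fM : forall x, M <= f x.
Hypothesis tau0 : forall k, 0 < tau k.
Hypothesis nU : forall k i, std_normal P (U k i).
Hypothesis iU : mutually_independent P (fun ki : nat * 'I_d => U ki.1 ki.2).

Local Notation fs := (fsm P (U 0%N) f sigma).
Local Notation X := (iter_x f m sigma x0 tau U).
Local Notation gap := (@descent_gap R d m R1 R2 sigma).
Local Notation st := (stat P U m f sigma).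

Let nu0 := nU 0%N.
Let iu0 := indep_layer iU 0%N.
Let mfs : vmeas fs := vmeas_fsm nu0 iu0 fspb s0.
Let mX g k (mg : vmeas g) := measurable_vmeas_iter sigma x0 tau fspb nU k mg.
Let step_k k := chain_step x0 fspb s0 fM tau0 nU iU k.

Let fs_ge x : 0 <= fs x - M.
Proof. by rewrite subr_ge0; exact: (fsm_ge nu0 iu0 fspb s0 fM). Qed.

Let stat_int_ge0 k : (0 <= \int[P]_w (st (X k w))%:E)%E.
Proof. by apply: integral_ge0 => w _; rewrite lee_fin stat_ge0. Qed.

(** Integrability propagates: [chain_step] bounds the nonnegative integral at step k + 1 by a finite
    number. *)
Lemma intg_iter_sub k : intg P (fun w => fs (X k w) - M).
Proof.
elim: k => [|k ih]; first exact: (intg_cst P (fs x0 - M)).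
apply: intg_ge0 => //; first by apply: measurable_funB => //; exact: mX.
apply: (@le_lt_trans _ _ (\int[P]_w (fs (X k.+1 w) - M)%:E
    + (tau k)%:E * \int[P]_w (st (X k w))%:E)%E).
  by rewrite leeDl// mule_ge0// lee_fin ltW.
by apply: le_lt_trans (step_k k) _; rewrite (intgE ih) -EFinD ltry.
Qed.

Lemma intg_iter k : intg P (fun w => fs (X k w)).
Proof.
have := intgD (intg_iter_sub k) (intg_cst P M).
by under eq_fun do rewrite subrK.
Qed.

Lemma intg_stat k : intg P (fun w => st (X k w)).
Proof.
apply: intg_ge0.
- by apply: mX; exact: (vmeas_stat fspb s0 nU iU).
- by move=> w; exact: stat_ge0.
have := step_k k; rewrite (intgE (intg_iter_sub k)) (intgE (intg_iter_sub k.+1)).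
move: (stat_int_ge0 k); case: (\int[P]_w _)%E => [r|//|//] _; first by rewrite ltry.
(* As tau k > 0, an infinite integral would contradict the finite right side of [chain_step]. *)
by rewrite gt0_muley ?lte_fin// addey.
Qed.

Lemma chain_real k :
  \int[P]_w fs (X k.+1 w) + tau k * \int[P]_w st (X k w) <=
  \int[P]_w fs (X k w) + gap (tau k).
Proof.
have := step_k k; rewrite (intgE (intg_iter_sub k)) (intgE (intg_iter_sub k.+1)).
rewrite (intgE (intg_stat k)) -EFinM -!EFinD lee_fin.
rewrite !(RintB (intg_iter _) (intg_cst P M)) !Rint_cst; lra.
Qed.

Lemma Rint_iter_ge k : M <= \int[P]_w fs (X k w).
Proof.
rewrite -subr_ge0 -[X in _ - X](Rint_cst P M) -(RintB (intg_iter _) (intg_cst P M)).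
by apply: Rintegral_ge0.
Qed.

Lemma chain_sum n :
  \sum_(k < n) tau k * \int[P]_w st (X k w) + \int[P]_w fs (X n w) <=
  fs x0 + \sum_(k < n) gap (tau k).
Proof.
elim: n => [|n ih]; first by rewrite !big_ord0 add0r addr0 (Rint_cst P (fs x0)).
by rewrite !big_ord_recr/=; have := chain_real n; lra.
Qed.

(** The origin of M(x^0): the telescoped sum starts at f_sigma(x^0), while the final bound is in
    terms of f(x^0). *)
Lemma fsm_x0_le : fs x0 <= f x0 + cM m R1 R2 sigma x0 * sigma.
Proof.
have h := df_le fspb s0 x0.
set k1 := (2 : R) ^ (m%:Z - 1) * R1 * enorm x0 ^+ m + R2 in h.
set k2 := (2 : R) ^ (m%:Z - 1) * R1 * sigma ^+ m in h.
have R1ge := SPB_R1_ge0 fspb; have R2ge := ltW (SPB_R2_gt0 fspb).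
have k10 : 0 <= k1.
  by rewrite addr_ge0// !mulr_ge0 ?exprz_ge0 ?exprn_ge0 ?enorm_ge0.
have k20 : 0 <= k2 by rewrite !mulr_ge0 ?exprz_ge0 ?exprn_ge0// ltW.
have i1 := moment_intg nu0 iu0 1; have i2 := moment_intg nu0 iu0 m.+1.
have m1 := moment1 nu0 iu0; have m2 := moment nu0 iu0 m.+1.
have id_ := intg_df nu0 iu0 fspb s0 x0.
have : \int[P]_w (f (x0 + sigma *: \row_i U 0%N i w) - f x0) <=
    sigma * (k1 * \int[P]_w (enorm (\row_i U 0%N i w) ^+ 1)
    + k2 * \int[P]_w (enorm (\row_i U 0%N i w) ^+ m.+1)).
  rewrite -(RintZ _ i1) -(RintZ _ i2) -(RintD (intgZ _ i1) (intgZ _ i2)).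
  rewrite -(RintZ _ (intgD (intgZ _ i1) (intgZ _ i2))).
  apply: Rint_le => //; first by apply: intgZ; apply: intgD; exact: intgZ.
  by move=> w; exact: le_trans (ler_norm _) (h _).
rewrite (RintB (intg_f nu0 iu0 fspb s0 x0) (intg_cst P (f x0))) Rint_cst -/(fs x0).
move=> hle; rewrite -lerBlDl; apply: le_trans hle _.
rewrite [leRHS]mulrC; apply: ler_wpM2l; first exact: ltW.
rewrite /cM -/k1 -/k2 addn1; apply: lerD.
  by apply: ler_wpM2l.
by apply: ler_wpM2l.
Qed.

End telescope.

Theorem theorem4p8 (R : realType) (d : nat) (dT : measure_display)
  (T : measurableType dT) (P : probability T R)
  (U : nat -> 'I_d -> T -> R) (f : 'rV[R]_d -> R) (R1 R2 : R) (m : nat)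
  (sigma : R) (x0 : 'rV[R]_d) (tau : nat -> R) :
  SPB f R1 R2 m ->
  (exists M : R, forall x, M <= f x) ->
  0 < sigma ->
  (forall k, 0 < tau k <= 1) ->
  (forall k i, std_normal P (U k i)) ->
  mutually_independent P (fun ki : nat * 'I_d => U ki.1 ki.2) ->
  let fs := fsmooth P (U 0%N) f sigma in
  let x := iter_x f m sigma x0 tau U in
  let H := cH d m R1 R2 sigma in
  let A := cA d m R1 R2 sigma in
  let B := cB d m R1 sigma in
  let C := cC d m R1 sigma in
  (forall k : nat,
     ('E_P[fun w => fs (x k.+1 w)] <=
      'E_P[fun w => fs (x k w)]
      + (H 2%N * tau k ^+ 2 * (A + B) / 2
         + C / (m + 2)%:R * H (m + 2)%N * tau k ^+ (m + 2))%:E)%E)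
  /\
  (forall Tn : nat, (0 < Tn)%N ->
     (\big[mine/+oo%E]_(k < Tn.+1)
        'E_P[fun w => (enorm (grad fs (x k w)) ^+ 2
                      / (enorm (x k w) ^+ m + 1) ^+ 2)%R]
      <= ((cM m R1 R2 sigma x0 * sigma + f x0 - inf (range f)
           + 2^-1 * H 2%N * (A + B) * \sum_(k < Tn.+1) tau k ^+ 2
           + H (m + 2)%N * C / (m + 2)%:R * \sum_(k < Tn.+1) tau k ^+ (m + 2))
          / \sum_(k < Tn.+1) tau k)%:E)%E).
Proof.
move=> fspb [M0 fM0] s0 tau01 nU iU fs x H A B C.
pose M := inf (range f).
have fM y : M <= f y.
  by apply: ge_inf; [exists M0 => _ [z _ <-]|exists y].
have tau0 k : 0 < tau k by case/andP: (tau01 k).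
have nu0 := nU 0%N; have iu0 := indep_layer iU 0%N.
have fsE : fs = fsm P (U 0%N) f sigma.
  by apply/funext => y; rewrite /fs /fsmooth unlock.
have Efs k : ('E_P[fun w => fs (x k w)])%E = (\int[P]_w fsm P (U 0%N) f sigma (x k w))%:E.
  rewrite unlock fsE; apply: intgE.
  exact: (intg_iter x0 fspb s0 fM tau0 nU iU).
split=> [k|n _].
  rewrite !Efs -EFinD lee_fin.
  have := chain_real x0 fspb s0 fM tau0 nU iU k.
  have : 0 <= \int[P]_w stat P U m f sigma (x k w).
    by apply: Rintegral_ge0 => w _; exact: stat_ge0.
  move=> h0 h1; apply: le_trans h1; rewrite lerDl.
  exact: mulr_ge0 (ltW (tau0 k)) h0.
have Est k : ('E_P[fun w => (enorm (grad fs (x k w)) ^+ 2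
                 / (enorm (x k w) ^+ m + 1) ^+ 2)%R])%E =
    (\int[P]_w stat P U m f sigma (x k w))%:E.
  rewrite unlock fsE -(intgE (intg_stat x0 fspb s0 fM tau0 nU iU k)).
  by apply: eq_integral => w _; rewrite (grad_fsm nu0 iu0 fspb s0 fM).
(* Were the minimum larger than the bound, every term would be; weighting by tau_k > 0 and summing
   would contradict the telescoped inequality. *)
rewrite leNgt; apply/negP => /bigmin_gtP[_ hlt].
have St0 : 0 < \sum_(k < n.+1) tau k.
  by rewrite big_ord_recr/= ltr_wpDl// sumr_ge0// => i _; exact: ltW.
move: hlt; set N := (X in (X / _)%:E) => hlt.
have : \sum_(k < n.+1) tau k * (N / \sum_(k < n.+1) tau k) <
    \sum_(k < n.+1) tau k * \int[P]_w stat P U m f sigma (x k w).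
  apply: ltr_sum => [|i _]; first by apply/hasP; exists ord0; rewrite ?mem_index_enum.
  by rewrite ltr_pM2l// -lte_fin -Est; exact: hlt.
rewrite -mulr_suml mulrCA divff ?gt_eqF// mulr1; apply/negP; rewrite -leNgt.
have h1 := chain_sum x0 fspb s0 fM tau0 nU iU n.+1.
have h2 := Rint_iter_ge x0 fspb s0 fM tau0 nU iU n.+1.
have h3 := fsm_x0_le x0 fspb s0 nU iU.
have gE : \sum_(k < n.+1) @descent_gap R d m R1 R2 sigma (tau k) =
   2^-1 * H 2%N * (A + B) * \sum_(k < n.+1) tau k ^+ 2
   + H (m + 2)%N * C / (m + 2)%:R * \sum_(k < n.+1) tau k ^+ (m + 2).
  rewrite !mulr_sumr -big_split; apply: eq_bigr => i _.
  by rewrite /descent_gap -/H -/A -/B -/C /=; ring.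
rewrite gE in h1; rewrite /N -/M -/x in h1 h2 *.
set Z := (X in X <= _); set z1 := _ * \sum_(k < n.+1) tau k ^+ 2 in h1 *.
set z2 := _ * \sum_(k < n.+1) tau k ^+ (m + 2) in h1 *.
rewrite -/Z in h1.
by clearbody Z z1 z2; lra.
Qed.
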